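(* Let $\Gamma$ be a simply laced Dynkin diagram of finite type, i.e. the diagram obtained by removing vertex $0$ from one of the affine diagrams $A_n^{(1)}$ ($n\ge2$), $D_n^{(1)}$ ($n\ge4$), $E_6^{(1)}$, $E_7^{(1)}$, $E_8^{(1)}$ (so $\Gamma$ is $A_n$, $D_n$, $E_6$, $E_7$ or $E_8$), with vertex set $\Pi$. Let $\mathfrak{g}$ be the corresponding Chevalley algebra over a field $K$ of characteristic unequal to $2$, and let $\mathfrak{n}_+$ be the subalgebra of $\mathfrak{g}$ generated by the $E_x^0$, $x\in\Pi$. Then the map sending $x\in\Pi$ to $E_x^0$ induces a (necessarily unique) isomorphism of Lie algebras $\mathcal{L}(0)\to\mathfrak{n}_+$.
   Context: Write $x\sim y$ if $x,y\in\Pi$ are adjacent in $\Gamma$. $\mathcal{F}$ is the quotient of the free Lie algebra over $K$ on $\Pi$ modulo the relations $[x,y]=0$ for $x,y\in\Pi$ with $x\not\sim y$, and $\mathcal{L}(0)$ is the quotient of $\mathcal{F}$ by the ideal generated by all elements $[x,[x,y]]$ with $x\in\Pi$, $y\in\mathcal{F}$. Chevalley algebra: let $\mathfrak{g}_{\mathbb{C}}$ be the complex simple Lie algebra of type $\Gamma$ with Chevalley generators $E_x,H_x,F_x$ ($x\in\Pi$), and let $\Phi$ be its root system with simple roots $\alpha_x$. It has a Chevalley basis, consisting of the $H_x$ and a vector $E_\alpha$ in each root space ($\alpha\in\Phi$), with $E_{\alpha_x}=E_x$, $E_{-\alpha_x}=F_x$. The $\mathbb{Z}$-span of this basis is a $\mathbb{Z}$-subalgebra;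 $\mathfrak{g}$ is the $K$-Lie algebra obtained by tensoring it with $K$, and $E_x^0,H_x^0,F_x^0\in\mathfrak{g}$ are the images of $E_x,H_x,F_x$. *)

(* Defs.v *)
From HB Require Import structures.
From mathcomp Require Import all_boot all_order all_algebra.
From mathcomp Require Import boolp classical_sets reals.
From mathcomp Require Import complex.

Set Implicit Arguments.
Unset Strict Implicit.
Unset Printing Implicit Defensive.

Import Order.TTheory GRing.Theory Num.Theory.
Local Open Scope ring_scope.
Local Open Scope classical_set_scope.
Local Open Scope quotient_scope.

HB.mixin Record Zmodule_isLieRing L of GRing.Zmodule L := {
  lbr : L -> L -> L;
  lbrDl : forall x y z, lbr (x + y) z = lbr x z + lbr y z;
  lbrDr : forall x y z, lbr x (y + z) = lbr x y + lbr x z;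
  lbrxx : forall x, lbr x x = 0;
  lbr_jacobi : forall x y z,
    lbr x (lbr y z) + lbr y (lbr z x) + lbr z (lbr x y) = 0
}.

#[short(type="lieRingType")]
HB.structure Definition LieRing := {L of GRing.Zmodule L & Zmodule_isLieRing L}.

HB.mixin Record LieRing_isLieAlgebra (R : comNzRingType) L
    of LieRing L & GRing.Lmodule R L := {
  lbrZl : forall (c : R) (x y : L), lbr (c *: x) y = c *: lbr x y;
  lbrZr : forall (c : R) (x y : L), lbr x (c *: y) = c *: lbr x y
}.

#[short(type="lieAlgType")]
HB.structure Definition LieAlgebra (R : comNzRingType) :=
  {L of LieRing L & GRing.Lmodule R L & LieRing_isLieAlgebra R L}.

#[short(type="lieVectType")]
HB.structure Definition LieVector (R : comNzRingType) :=
  {L of LieAlgebra R L & Vector R L}.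

Notation "[! x , y ]" := (lbr x y)
  (at level 0, x, y at level 99, format "[! x ,  y ]") : ring_scope.

Section LieRingTheory.
Variable L : lieRingType.
Implicit Types x y : L.

Lemma lbr0r x : [!x, 0] = 0.
Proof. by apply: (addrI [!x, 0]); rewrite -lbrDr !addr0. Qed.

Lemma lbr0l x : [!0, x] = 0.
Proof. by apply: (addrI [!0, x]); rewrite -lbrDl !addr0. Qed.

Lemma lbrC x y : [!x, y] = - [!y, x].
Proof.
apply/eqP; rewrite -addr_eq0; apply/eqP.
by have := lbrxx (x + y); rewrite lbrDl !lbrDr !lbrxx add0r addr0.
Qed.

Lemma lbrNl x y : [!- x, y] = - [!x, y].
Proof. by apply: (addrI [!x, y]); rewrite -lbrDl !subrr lbr0l. Qed.

Lemma lbrNr x y : [!x, - y] = - [!x, y].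
Proof. by rewrite lbrC lbrNl -lbrC. Qed.

End LieRingTheory.

Section LieNotions.
Variable R : comNzRingType.

Definition lie_hom (L1 L2 : lieAlgType R) (f : L1 -> L2) : Prop :=
  linear f /\ forall x y, f [!x, y] = [!f x, f y].

Definition lie_iso (L1 L2 : lieAlgType R) (f : L1 -> L2) : Prop :=
  lie_hom f /\ bijective f.

Definition lie_subalgebra (L : lieAlgType R) (A : set L) : Prop :=
  [/\ A 0,
      forall x y, A x -> A y -> A (x + y),
      forall (c : R) x, A x -> A (c *: x) &
      forall x y, A x -> A y -> A [!x, y]].

Definition lie_ideal (L : lieAlgType R) (I : set L) : Prop :=
  [/\ I 0,
      forall x y, I x -> I y -> I (x + y),
      forall (c : R) x, I x -> I (c *: x) &
      forall x y, I y -> I [!x, y]].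

Definition lie_simple (L : lieAlgType R) : Prop :=
  (exists x y : L, [!x, y] <> 0) /\
  forall I : set L, lie_ideal I -> I = [set 0] \/ I = setT.

End LieNotions.

Section PropQuotient.
Variables (T : choiceType) (e : T -> T -> Prop).
Hypothesis er : forall x, e x x.
Hypothesis es : forall x y, e x y -> e y x.
Hypothesis et : forall y x z, e x y -> e y z -> e x z.

Definition prop_rel : rel T := fun x y => `[< e x y >].

Lemma prop_rel_refl : reflexive prop_rel.
Proof. by move=> x; apply/asboolP. Qed.
Lemma prop_rel_sym : symmetric prop_rel.
Proof. by move=> x y; apply/asboolP/asboolP; apply: es. Qed.
Lemma prop_rel_trans : transitive prop_rel.
Proof. by move=> y x z /asboolP h /asboolP k; apply/asboolP; apply: et k. Qed.

Definition prop_equiv : equiv_rel T :=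
  EquivRel prop_rel prop_rel_refl prop_rel_sym prop_rel_trans.

Lemma prop_piP x y : \pi_({eq_quot prop_equiv}) x = \pi y <-> e x y.
Proof. by split=> [/eqmodP/asboolP|h]; [|apply/eqmodP/asboolP]. Qed.

Lemma prop_reprP x : e (repr (\pi_({eq_quot prop_equiv}) x)) x.
Proof. by apply/prop_piP; rewrite reprK. Qed.

End PropQuotient.

(* The free Lie algebra on X is the type of formal Lie expressions in X modulo
   the congruence lie_eq generated by the axioms of a Lie algebra; its universal
   property is free_lie_liftP and free_lie_lift_uniq. *)
Inductive lie_term (R : comNzRingType) (X : Type) : Type :=
| LVar of X
| LZero
| LAdd of lie_term R X & lie_term R X
| LScale of R & lie_term R X
| LBr of lie_term R X & lie_term R X.

Arguments LVar {R X}.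
Arguments LZero {R X}.

HB.instance Definition _ R X := gen_eqMixin (lie_term R X).
HB.instance Definition _ R X := gen_choiceMixin (lie_term R X).

Section FreeLie.
Variables (R : comNzRingType) (X : Type).
Local Notation term := (lie_term R X).

Inductive lie_eq : term -> term -> Prop :=
| lieq_refl s : lie_eq s s
| lieq_sym s t : lie_eq s t -> lie_eq t s
| lieq_trans t s u : lie_eq s t -> lie_eq t u -> lie_eq s u
| lieq_add s s' t t' :
    lie_eq s s' -> lie_eq t t' -> lie_eq (LAdd s t) (LAdd s' t')
| lieq_scale c s s' : lie_eq s s' -> lie_eq (LScale c s) (LScale c s')
| lieq_br s s' t t' :
    lie_eq s s' -> lie_eq t t' -> lie_eq (LBr s t) (LBr s' t')
| lieq_addA s t u : lie_eq (LAdd s (LAdd t u)) (LAdd (LAdd s t) u)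
| lieq_addC s t : lie_eq (LAdd s t) (LAdd t s)
| lieq_add0 s : lie_eq (LAdd LZero s) s
| lieq_addN s : lie_eq (LAdd (LScale (-1) s) s) LZero
| lieq_scaleA a b s : lie_eq (LScale a (LScale b s)) (LScale (a * b) s)
| lieq_scale1 s : lie_eq (LScale 1 s) s
| lieq_scaleDr a s t :
    lie_eq (LScale a (LAdd s t)) (LAdd (LScale a s) (LScale a t))
| lieq_scaleDl a b s :
    lie_eq (LScale (a + b) s) (LAdd (LScale a s) (LScale b s))
| lieq_brDl s t u : lie_eq (LBr (LAdd s t) u) (LAdd (LBr s u) (LBr t u))
| lieq_brDr s t u : lie_eq (LBr s (LAdd t u)) (LAdd (LBr s t) (LBr s u))
| lieq_brZl a s t : lie_eq (LBr (LScale a s) t) (LScale a (LBr s t))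
| lieq_brZr a s t : lie_eq (LBr s (LScale a t)) (LScale a (LBr s t))
| lieq_brxx s : lie_eq (LBr s s) LZero
| lieq_jacobi s t u :
    lie_eq (LAdd (LAdd (LBr s (LBr t u)) (LBr t (LBr u s))) (LBr u (LBr s t)))
           LZero.

Definition free_lie : Type :=
  {eq_quot (prop_equiv lieq_refl lieq_sym lieq_trans)}.
HB.instance Definition _ := Choice.on free_lie.
HB.instance Definition _ := EqQuotient.on free_lie.

Local Notation cl := (\pi_free_lie).

Let clP s t : cl s = cl t <-> lie_eq s t.
Proof. exact: prop_piP. Qed.
Let reprP s : lie_eq (repr (cl s)) s.
Proof. exact: prop_reprP. Qed.
Let clE (P : free_lie -> Prop) : (forall s, P (cl s)) -> forall x, P x.
Proof. by move=> h x; rewrite -[x]reprK. Qed.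

Definition free_lie_add (x y : free_lie) : free_lie := cl (LAdd (repr x) (repr y)).
Definition free_lie_scale c (x : free_lie) : free_lie := cl (LScale c (repr x)).
Definition free_lie_br (x y : free_lie) : free_lie := cl (LBr (repr x) (repr y)).

Let addE s t : free_lie_add (cl s) (cl t) = cl (LAdd s t).
Proof. by apply/clP/lieq_add; apply: reprP. Qed.
Let scaleE c s : free_lie_scale c (cl s) = cl (LScale c s).
Proof. by apply/clP/lieq_scale; apply: reprP. Qed.
Let brE s t : free_lie_br (cl s) (cl t) = cl (LBr s t).
Proof. by apply/clP/lieq_br; apply: reprP. Qed.

Let addA : associative free_lie_add.
Proof.
by elim/clE=> s; elim/clE=> t; elim/clE=> u; rewrite !addE; apply/clP; constructor.
Qed.
Let addC : commutative free_lie_add.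
Proof. by elim/clE=> s; elim/clE=> t; rewrite !addE; apply/clP; apply: lieq_addC. Qed.
Let add0 : left_id (cl LZero) free_lie_add.
Proof. by elim/clE=> s; rewrite !addE; apply/clP; constructor. Qed.
Let addN : left_inverse (cl LZero) (free_lie_scale (-1)) free_lie_add.
Proof. by elim/clE=> s; rewrite scaleE addE; apply/clP; constructor. Qed.

HB.instance Definition _ := GRing.isZmodule.Build free_lie addA addC add0 addN.

Let addE' s t : cl s + cl t = cl (LAdd s t). Proof. exact: addE. Qed.

Let scaleA a b (x : free_lie) :
  free_lie_scale a (free_lie_scale b x) = free_lie_scale (a * b) x.
Proof. by elim/clE: x => s; rewrite !scaleE; apply/clP; constructor. Qed.
Let scale1 : left_id 1 free_lie_scale.
Proof. by elim/clE=> s; rewrite !scaleE; apply/clP; constructor. Qed.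
Let scaleDr : right_distributive free_lie_scale +%R.
Proof.
move=> a; elim/clE=> s; elim/clE=> t.
by rewrite addE' !scaleE addE'; apply/clP; constructor.
Qed.
Let scaleDl (x : free_lie) :
  {morph (fun c => free_lie_scale c x) : a b / a + b}.
Proof.
move=> a b; elim/clE: x => s.
by rewrite !scaleE addE'; apply/clP; constructor.
Qed.

HB.instance Definition _ :=
  GRing.Zmodule_isLmodule.Build R free_lie scaleA scale1 scaleDr scaleDl.

Let brDl (x y z : free_lie) :
  free_lie_br (x + y) z = free_lie_br x z + free_lie_br y z.
Proof.
elim/clE: x => s; elim/clE: y => t; elim/clE: z => u.
by rewrite !(brE, addE'); apply/clP; constructor.
Qed.
Let brDr (x y z : free_lie) :
  free_lie_br x (y + z) = free_lie_br x y + free_lie_br x z.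
Proof.
elim/clE: x => s; elim/clE: y => t; elim/clE: z => u.
by rewrite !(brE, addE'); apply/clP; constructor.
Qed.
Let brxx (x : free_lie) : free_lie_br x x = 0.
Proof. by elim/clE: x => s; rewrite brE; apply/clP; constructor. Qed.
Let brJ (x y z : free_lie) :
  free_lie_br x (free_lie_br y z) + free_lie_br y (free_lie_br z x)
    + free_lie_br z (free_lie_br x y) = 0.
Proof.
elim/clE: x => s; elim/clE: y => t; elim/clE: z => u.
by rewrite !(brE, addE'); apply/clP; constructor.
Qed.

HB.instance Definition _ := Zmodule_isLieRing.Build free_lie brDl brDr brxx brJ.

Let scaleE' c s : c *: cl s = cl (LScale c s). Proof. exact: scaleE. Qed.
Let brE' s t : [!cl s, cl t] = cl (LBr s t). Proof. exact: brE. Qed.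

Let brZl c (x y : free_lie) : [!c *: x, y] = c *: [!x, y].
Proof.
elim/clE: x => s; elim/clE: y => t.
by rewrite !(scaleE', brE'); apply/clP; constructor.
Qed.
Let brZr c (x y : free_lie) : [!x, c *: y] = c *: [!x, y].
Proof.
elim/clE: x => s; elim/clE: y => t.
by rewrite !(scaleE', brE'); apply/clP; constructor.
Qed.

HB.instance Definition _ := LieRing_isLieAlgebra.Build R free_lie brZl brZr.

Definition free_lie_var (x : X) : free_lie := cl (LVar x).

Section Lift.
Variables (L : lieAlgType R) (f : X -> L).

Fixpoint lie_term_eval (t : term) : L :=
  match t with
  | LVar x => f x
  | LZero => 0
  | LAdd s t => lie_term_eval s + lie_term_eval t
  | LScale c s => c *: lie_term_eval s
  | LBr s t => [!lie_term_eval s, lie_term_eval t]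
  end.

Lemma lie_term_eval_eq s t : lie_eq s t -> lie_term_eval s = lie_term_eval t.
Proof.
elim=> {s t} //=.
- by move=> t s u _ -> _ ->.
- by move=> s s' t t' _ -> _ ->.
- by move=> c s s' _ ->.
- by move=> s s' t t' _ -> _ ->.
- by move=> *; rewrite addrA.
- by move=> *; rewrite addrC.
- by move=> *; rewrite add0r.
- by move=> *; rewrite scaleN1r addNr.
- by move=> *; rewrite scalerA.
- by move=> *; rewrite scale1r.
- by move=> *; rewrite scalerDr.
- by move=> *; rewrite scalerDl.
- by move=> *; rewrite lbrDl.
- by move=> *; rewrite lbrDr.
- by move=> *; rewrite lbrZl.
- by move=> *; rewrite lbrZr.
- by move=> *; rewrite lbrxx.
- by move=> *; rewrite lbr_jacobi.
Qed.

Definition free_lie_lift (x : free_lie) : L := lie_term_eval (repr x).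

Let liftE s : free_lie_lift (cl s) = lie_term_eval s.
Proof. by apply: lie_term_eval_eq; apply: reprP. Qed.

Lemma free_lie_liftP :
  lie_hom free_lie_lift /\ forall x, free_lie_lift (free_lie_var x) = f x.
Proof.
split; last by move=> x; rewrite liftE.
split=> [c|]; elim/clE=> s; elim/clE=> t.
  by rewrite scaleE' addE' !liftE.
by rewrite brE' !liftE.
Qed.

Lemma free_lie_lift_uniq (g : free_lie -> L) :
  lie_hom g -> (forall x, g (free_lie_var x) = f x) -> g =1 free_lie_lift.
Proof.
case=> gl gb gv; elim/clE=> s; rewrite liftE.
have g0 : g 0 = 0.
  by apply: (addrI (g 0)); rewrite -{1}[g 0]scale1r -gl scale1r !addr0.
elim: s => //= [s IHs t IHt|c s IHs|s IHs t IHt].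
- by rewrite -IHs -IHt -{1}[g (cl s)]scale1r -gl scale1r addE'.
- by rewrite -IHs -[_ *: _]addr0 -g0 -gl addr0 scaleE'.
- by rewrite -IHs -IHt -gb brE'.
Qed.

End Lift.
End FreeLie.

(* The quotient of L by the ideal generated by S. *)
Section LieQuotient.
Variables (R : comNzRingType) (L : lieAlgType R) (S : set L).

Definition lie_ideal_gen : set L := smallest (@lie_ideal R L) S.

Lemma lie_ideal_genP : lie_ideal lie_ideal_gen.
Proof.
split.
- by move=> A [[]].
- by move=> x y Ix Iy A [hA sA]; case: (hA) => _ hD _ _; apply: hD; [exact: (Ix A)|exact: (Iy A)].
- by move=> c x Ix A [hA sA]; case: (hA) => _ _ hZ _; exact: (hZ _ _ (Ix A _)).
- by move=> x y Iy A [hA sA]; case: (hA) => _ _ _ hB; exact: (hB _ _ (Iy A _)).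
Qed.

Local Notation I := lie_ideal_gen.
Definition lie_quot_eq (x y : L) : Prop := I (x - y).

Let I0 : I 0. Proof. by case: lie_ideal_genP. Qed.
Let ID x y : I x -> I y -> I (x + y).
Proof. by case: lie_ideal_genP => _ h _ _; apply: h. Qed.
Let IZ c x : I x -> I (c *: x).
Proof. by case: lie_ideal_genP => _ _ h _; apply: h. Qed.
Let IB x y : I y -> I [!x, y].
Proof. by case: lie_ideal_genP => _ _ _ h; apply: h. Qed.
Let IN x : I x -> I (- x).
Proof. by rewrite -scaleN1r; apply: IZ. Qed.

Lemma lie_quot_eq_refl x : lie_quot_eq x x.
Proof. by rewrite /lie_quot_eq subrr. Qed.
Lemma lie_quot_eq_sym x y : lie_quot_eq x y -> lie_quot_eq y x.
Proof. by move/IN; rewrite opprB. Qed.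
Lemma lie_quot_eq_trans y x z :
  lie_quot_eq x y -> lie_quot_eq y z -> lie_quot_eq x z.
Proof. by move=> h k; have := ID h k; rewrite addrA subrK. Qed.

Definition lie_quot : Type :=
  {eq_quot (prop_equiv lie_quot_eq_refl lie_quot_eq_sym lie_quot_eq_trans)}.
HB.instance Definition _ := Choice.on lie_quot.
HB.instance Definition _ := EqQuotient.on lie_quot.

Definition lie_quot_pi (x : L) : lie_quot := \pi_lie_quot x.
Local Notation cl := lie_quot_pi.

Lemma lie_quot_piP x y : cl x = cl y <-> I (x - y).
Proof. exact: prop_piP. Qed.
Let clP := lie_quot_piP.
Let reprP x : I (repr (cl x) - x).
Proof. exact: (prop_reprP lie_quot_eq_refl lie_quot_eq_sym lie_quot_eq_trans). Qed.
Let clE (P : lie_quot -> Prop) : (forall s, P (cl s)) -> forall x, P x.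
Proof. by move=> h x; rewrite -[x]reprK; apply: h. Qed.

Definition lie_quot_add (x y : lie_quot) := cl (repr x + repr y).
Definition lie_quot_opp (x : lie_quot) := cl (- repr x).
Definition lie_quot_scale c (x : lie_quot) := cl (c *: repr x).
Definition lie_quot_br (x y : lie_quot) := cl [!repr x, repr y].

Let addE s t : lie_quot_add (cl s) (cl t) = cl (s + t).
Proof. by apply/clP; rewrite opprD addrACA; apply: ID; apply: reprP. Qed.
Let oppE s : lie_quot_opp (cl s) = cl (- s).
Proof. by apply/clP; rewrite -opprD; exact: (IN (reprP s)). Qed.
Let scaleE c s : lie_quot_scale c (cl s) = cl (c *: s).
Proof. by apply/clP; rewrite -scalerBr; exact: (IZ _ (reprP s)). Qed.
Let brE s t : lie_quot_br (cl s) (cl t) = cl [!s, t].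
Proof.
apply/clP; set a := repr _; set b := repr _.
have -> : [!a, b] - [!s, t] = [!a, b - t] - [!t, a - s].
  by rewrite !(lbrDr, lbrNr) (lbrC t a) (lbrC t s) opprD !opprK addrA addrNK.
exact: (ID (IB _ (reprP t)) (IN (IB _ (reprP s)))).
Qed.

Let addA : associative lie_quot_add.
Proof. by elim/clE=> s; elim/clE=> t; elim/clE=> u; rewrite !addE addrA. Qed.
Let addC : commutative lie_quot_add.
Proof. by elim/clE=> s; elim/clE=> t; rewrite !addE addrC. Qed.
Let add0 : left_id (cl 0) lie_quot_add.
Proof. by elim/clE=> s; rewrite !addE add0r. Qed.
Let addN : left_inverse (cl 0) lie_quot_opp lie_quot_add.
Proof. by elim/clE=> s; rewrite oppE addE addNr. Qed.

HB.instance Definition _ := GRing.isZmodule.Build lie_quot addA addC add0 addN.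

Let addE' s t : cl s + cl t = cl (s + t). Proof. exact: addE. Qed.

Let scaleA a b (x : lie_quot) :
  lie_quot_scale a (lie_quot_scale b x) = lie_quot_scale (a * b) x.
Proof. by elim/clE: x => s; rewrite !scaleE scalerA. Qed.
Let scale1 : left_id 1 lie_quot_scale.
Proof. by elim/clE=> s; rewrite !scaleE scale1r. Qed.
Let scaleDr : right_distributive lie_quot_scale +%R.
Proof.
move=> a; elim/clE=> s; elim/clE=> t.
by rewrite addE' !scaleE addE' scalerDr.
Qed.
Let scaleDl (x : lie_quot) :
  {morph (fun c => lie_quot_scale c x) : a b / a + b}.
Proof.
move=> a b; elim/clE: x => s.
by rewrite !scaleE addE' scalerDl.
Qed.

HB.instance Definition _ :=
  GRing.Zmodule_isLmodule.Build R lie_quot scaleA scale1 scaleDr scaleDl.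

Let brDl (x y z : lie_quot) :
  lie_quot_br (x + y) z = lie_quot_br x z + lie_quot_br y z.
Proof.
elim/clE: x => s; elim/clE: y => t; elim/clE: z => u.
by rewrite addE' !brE addE' lbrDl.
Qed.
Let brDr (x y z : lie_quot) :
  lie_quot_br x (y + z) = lie_quot_br x y + lie_quot_br x z.
Proof.
elim/clE: x => s; elim/clE: y => t; elim/clE: z => u.
by rewrite addE' !brE addE' lbrDr.
Qed.
Let brxx (x : lie_quot) : lie_quot_br x x = 0.
Proof. by elim/clE: x => s; rewrite brE lbrxx. Qed.
Let brJ (x y z : lie_quot) :
  lie_quot_br x (lie_quot_br y z) + lie_quot_br y (lie_quot_br z x)
    + lie_quot_br z (lie_quot_br x y) = 0.
Proof.
elim/clE: x => s; elim/clE: y => t; elim/clE: z => u.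
by rewrite !(brE, addE') lbr_jacobi.
Qed.

HB.instance Definition _ := Zmodule_isLieRing.Build lie_quot brDl brDr brxx brJ.

Let scaleE' c s : c *: cl s = cl (c *: s). Proof. exact: scaleE. Qed.
Let brE' s t : [!cl s, cl t] = cl [!s, t]. Proof. exact: brE. Qed.

Let brZl c (x y : lie_quot) : [!c *: x, y] = c *: [!x, y].
Proof.
elim/clE: x => s; elim/clE: y => t.
by rewrite !(scaleE', brE') lbrZl.
Qed.
Let brZr c (x y : lie_quot) : [!x, c *: y] = c *: [!x, y].
Proof.
elim/clE: x => s; elim/clE: y => t.
by rewrite !(scaleE', brE') lbrZr.
Qed.

HB.instance Definition _ := LieRing_isLieAlgebra.Build R lie_quot brZl brZr.

Lemma lie_quot_pi_hom : lie_hom lie_quot_pi.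
Proof.
split=> [c s t|s t]; last by rewrite -brE'.
by rewrite -addE' -scaleE'.
Qed.

End LieQuotient.

(* The subalgebra of L generated by S, as a Lie algebra in its own right. *)
Section SubLie.
Variables (R : comNzRingType) (L : lieAlgType R) (S : set L).

Definition lie_gen : set L := smallest (@lie_subalgebra R L) S.

Lemma lie_genP : lie_subalgebra lie_gen.
Proof.
split.
- by move=> A [[]].
- by move=> x y Ix Iy A [hA sA]; case: (hA) => _ hD _ _; apply: hD; [exact: (Ix A)|exact: (Iy A)].
- by move=> c x Ix A [hA sA]; case: (hA) => _ _ hZ _; exact: (hZ _ _ (Ix A _)).
- by move=> x y Ix Iy A [hA sA]; case: (hA) => _ _ _ hB; apply: hB; [exact: (Ix A)|exact: (Iy A)].
Qed.

Definition lie_gen_pred : pred L := fun x => `[< lie_gen x >].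

Lemma lie_gen_submod : submod_closed lie_gen_pred.
Proof.
case: lie_genP => h0 hD hZ _; split; first exact/asboolP.
by move=> c x y /asboolP hx /asboolP hy; apply/asboolP; exact: (hD _ _ (hZ c _ hx) hy).
Qed.
HB.instance Definition _ :=
  GRing.isSubmodClosed.Build R L lie_gen_pred lie_gen_submod.

Record sub_lie : Type := SubLie {
  sub_lie_val :> L;
  sub_lie_valP : lie_gen_pred sub_lie_val
}.
HB.instance Definition _ := [isSub for sub_lie_val].
HB.instance Definition _ := [Choice of sub_lie by <:].
HB.instance Definition _ := [SubChoice_isSubLmodule of sub_lie by <:].

Lemma sub_lie_brP (x y : sub_lie) : lie_gen_pred [!val x, val y].
Proof.
case: lie_genP => _ _ _ hB; apply/asboolP.
exact: (hB _ _ (asboolW (valP x)) (asboolW (valP y))).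
Qed.
Definition sub_lie_br (x y : sub_lie) : sub_lie := SubLie (sub_lie_brP x y).

Let v := sub_lie_val.
Let vD x y : v (x + y) = v x + v y. Proof. exact: (raddfD val). Qed.
Let v0 : v 0 = 0. Proof. exact: (raddf0 val). Qed.
Let vZ c x : v (c *: x) = c *: v x. Proof. exact: (linearZZ (\val : {linear sub_lie -> L})). Qed.
Let vB x y : v (sub_lie_br x y) = [!v x, v y]. Proof. by []. Qed.

Let brDl (x y z : sub_lie) : sub_lie_br (x + y) z = sub_lie_br x z + sub_lie_br y z.
Proof. by apply: val_inj; rewrite -[LHS]/(v _) -[RHS]/(v _) !(vB, vD) lbrDl. Qed.
Let brDr (x y z : sub_lie) : sub_lie_br x (y + z) = sub_lie_br x y + sub_lie_br x z.
Proof. by apply: val_inj; rewrite -[LHS]/(v _) -[RHS]/(v _) !(vB, vD) lbrDr. Qed.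
Let brxx (x : sub_lie) : sub_lie_br x x = 0.
Proof. by apply: val_inj; rewrite -[LHS]/(v _) -[RHS]/(v _) vB v0 lbrxx. Qed.
Let brJ (x y z : sub_lie) :
  sub_lie_br x (sub_lie_br y z) + sub_lie_br y (sub_lie_br z x)
    + sub_lie_br z (sub_lie_br x y) = 0.
Proof.
by apply: val_inj; rewrite -[LHS]/(v _) -[RHS]/(v _) !(vD, vB) v0 lbr_jacobi.
Qed.
HB.instance Definition _ := Zmodule_isLieRing.Build sub_lie brDl brDr brxx brJ.

Let brZl c (x y : sub_lie) : [!c *: x, y] = c *: [!x, y].
Proof.
apply: val_inj; rewrite -[LHS]/(v _) -[RHS]/(v _) vZ.
by rewrite -[LHS]/[!v (c *: x), v y] vZ lbrZl.
Qed.
Let brZr c (x y : sub_lie) : [!x, c *: y] = c *: [!x, y].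
Proof.
apply: val_inj; rewrite -[LHS]/(v _) -[RHS]/(v _) vZ.
by rewrite -[LHS]/[!v x, v (c *: y)] vZ lbrZr.
Qed.
HB.instance Definition _ := LieRing_isLieAlgebra.Build R sub_lie brZl brZr.

Lemma mem_lie_gen x : S x -> lie_gen_pred x.
Proof. by move=> Sx; apply/asboolP => A [_]; apply. Qed.

End SubLie.

(* tensor K M is the tensor product of K and M over Z: formal sums of symbols
   a (x) m modulo the congruence tens_eq generated by the axioms of an abelian
   group and biadditivity (balancedness over Z is then automatic). *)
Inductive tens_term (K M : Type) : Type :=
| TPure of K & M
| TZero
| TAdd of tens_term K M & tens_term K M
| TOpp of tens_term K M.

Arguments TZero {K M}.

HB.instance Definition _ K M := gen_eqMixin (tens_term K M).
HB.instance Definition _ K M := gen_choiceMixin (tens_term K M).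

Section Tensor.
Variable K : comNzRingType.

Section Module.
Variable M : zmodType.
Local Notation term := (tens_term K M).

Inductive tens_eq : term -> term -> Prop :=
| teq_refl s : tens_eq s s
| teq_sym s t : tens_eq s t -> tens_eq t s
| teq_trans t s u : tens_eq s t -> tens_eq t u -> tens_eq s u
| teq_add s s' t t' :
    tens_eq s s' -> tens_eq t t' -> tens_eq (TAdd s t) (TAdd s' t')
| teq_opp s s' : tens_eq s s' -> tens_eq (TOpp s) (TOpp s')
| teq_addA s t u : tens_eq (TAdd s (TAdd t u)) (TAdd (TAdd s t) u)
| teq_addC s t : tens_eq (TAdd s t) (TAdd t s)
| teq_add0 s : tens_eq (TAdd TZero s) s
| teq_addN s : tens_eq (TAdd (TOpp s) s) TZero
| teq_pureDl a b m : tens_eq (TPure (a + b) m) (TAdd (TPure a m) (TPure b m))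
| teq_pureDr a m n : tens_eq (TPure a (m + n)) (TAdd (TPure a m) (TPure a n)).

Definition tensor : Type :=
  {eq_quot (prop_equiv teq_refl teq_sym teq_trans)}.
HB.instance Definition _ := Choice.on tensor.
HB.instance Definition _ := EqQuotient.on tensor.

Local Notation cl := (\pi_tensor).

Let clP s t : cl s = cl t <-> tens_eq s t.
Proof. exact: prop_piP. Qed.
Let reprP s : tens_eq (repr (cl s)) s.
Proof. exact: prop_reprP. Qed.
Let clE (P : tensor -> Prop) : (forall s, P (cl s)) -> forall x, P x.
Proof. by move=> h x; rewrite -[x]reprK. Qed.

Definition tensor_add (x y : tensor) : tensor := cl (TAdd (repr x) (repr y)).
Definition tensor_opp (x : tensor) : tensor := cl (TOpp (repr x)).

Let addE s t : tensor_add (cl s) (cl t) = cl (TAdd s t).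
Proof. by apply/clP/teq_add; apply: reprP. Qed.
Let oppE s : tensor_opp (cl s) = cl (TOpp s).
Proof. by apply/clP/teq_opp; apply: reprP. Qed.
Let addA : associative tensor_add.
Proof.
by elim/clE=> s; elim/clE=> t; elim/clE=> u; rewrite !addE; apply/clP; constructor.
Qed.
Let addC : commutative tensor_add.
Proof. by elim/clE=> s; elim/clE=> t; rewrite !addE; apply/clP; apply: teq_addC. Qed.
Let add0 : left_id (cl TZero) tensor_add.
Proof. by elim/clE=> s; rewrite !addE; apply/clP; constructor. Qed.
Let addN : left_inverse (cl TZero) tensor_opp tensor_add.
Proof. by elim/clE=> s; rewrite oppE addE; apply/clP; constructor. Qed.

HB.instance Definition _ := GRing.isZmodule.Build tensor addA addC add0 addN.

Let addE' s t : cl s + cl t = cl (TAdd s t). Proof. exact: addE. Qed.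
Let oppE' s : - cl s = cl (TOpp s). Proof. exact: oppE. Qed.

Definition pure (a : K) (m : M) : tensor := cl (TPure a m).

Lemma pureDl a b m : pure (a + b) m = pure a m + pure b m.
Proof. by rewrite addE'; apply/clP; constructor. Qed.
Lemma pureDr a m n : pure a (m + n) = pure a m + pure a n.
Proof. by rewrite addE'; apply/clP; constructor. Qed.

Lemma pure0r a : pure a 0 = 0.
Proof. by apply: (addrI (pure a 0)); rewrite -pureDr !addr0. Qed.
Lemma pureNr a m : pure a (- m) = - pure a m.
Proof. by apply: (addrI (pure a m)); rewrite -pureDr !subrr pure0r. Qed.

Lemma tensor_ind (P : tensor -> Prop) :
  (forall a m, P (pure a m)) -> P 0 ->
  (forall x y, P x -> P y -> P (x + y)) -> (forall x, P x -> P (- x)) ->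
  forall x, P x.
Proof.
move=> hp h0 hD hN; elim/clE; elim=> // [s IHs t IHt|s IHs].
  by rewrite -addE'; apply: hD.
by rewrite -oppE'; apply: hN.
Qed.

Section Lift.
Variables (V : zmodType) (f : K -> M -> V).
Hypothesis fDl : forall a b m, f (a + b) m = f a m + f b m.
Hypothesis fDr : forall a m n, f a (m + n) = f a m + f a n.

Fixpoint tens_term_eval (t : term) : V :=
  match t with
  | TPure a m => f a m
  | TZero => 0
  | TAdd s t => tens_term_eval s + tens_term_eval t
  | TOpp s => - tens_term_eval s
  end.

Lemma tens_term_eval_eq s t :
  tens_eq s t -> tens_term_eval s = tens_term_eval t.
Proof.
elim=> {s t} //=.
- by move=> t s u _ -> _ ->.
- by move=> s s' t t' _ -> _ ->.
- by move=> s s' _ ->.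
- by move=> *; rewrite addrA.
- by move=> *; rewrite addrC.
- by move=> *; rewrite add0r.
- by move=> *; rewrite addNr.
Qed.
End Lift.

Definition tensor_lift (V : zmodType) (f : K -> M -> V) (x : tensor) : V :=
  tens_term_eval f (repr x).

Section LiftTheory.
Variables (V : zmodType) (f : K -> M -> V).
Hypothesis fDl : forall a b m, f (a + b) m = f a m + f b m.
Hypothesis fDr : forall a m n, f a (m + n) = f a m + f a n.

Let liftE s : tensor_lift f (cl s) = tens_term_eval f s.
Proof. by apply: tens_term_eval_eq => //; apply: reprP. Qed.

Lemma tensor_lift_pure a m : tensor_lift f (pure a m) = f a m.
Proof. exact: liftE. Qed.
Lemma tensor_lift0 : tensor_lift f 0 = 0.
Proof. exact: liftE. Qed.
Lemma tensor_liftD : {morph tensor_lift f : x y / x + y}.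
Proof.
elim/clE=> s; elim/clE=> t.
by rewrite addE' !liftE.
Qed.
Lemma tensor_liftN : {morph tensor_lift f : x / - x}.
Proof. by elim/clE=> s; rewrite oppE' !liftE. Qed.
End LiftTheory.

Definition tensor_scale (c : K) : tensor -> tensor :=
  tensor_lift (fun a m => pure (c * a) m).

Let sDl c a b m : pure (c * (a + b)) m = pure (c * a) m + pure (c * b) m.
Proof. by rewrite mulrDr pureDl. Qed.
Let sDr c a m n : pure (c * a) (m + n) = pure (c * a) m + pure (c * a) n.
Proof. by rewrite pureDr. Qed.
Let sE c a m : tensor_scale c (pure a m) = pure (c * a) m.
Proof. exact: tensor_lift_pure. Qed.
Let s0 c : tensor_scale c 0 = 0. Proof. exact: tensor_lift0. Qed.
Let sD c : {morph tensor_scale c : x y / x + y}. Proof. exact: tensor_liftD. Qed.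
Let sN c : {morph tensor_scale c : x / - x}. Proof. exact: tensor_liftN. Qed.

Let scaleA a b x : tensor_scale a (tensor_scale b x) = tensor_scale (a * b) x.
Proof.
elim/tensor_ind: x => [c m||x y IHx IHy|x IHx].
- by rewrite !sE mulrA.
- by rewrite !s0.
- by rewrite !sD IHx IHy.
- by rewrite !sN IHx.
Qed.
Let scale1 : left_id 1 tensor_scale.
Proof.
elim/tensor_ind=> [c m||x y IHx IHy|x IHx].
- by rewrite sE mul1r.
- by rewrite s0.
- by rewrite sD IHx IHy.
- by rewrite sN IHx.
Qed.
Let scaleDl x : {morph (fun c => tensor_scale c x) : a b / a + b}.
Proof.
move=> a b; elim/tensor_ind: x => [c m||x y IHx IHy|x IHx].
- by rewrite !sE mulrDl pureDl.
- by rewrite !s0 addr0.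
- by rewrite !sD IHx IHy addrACA.
- by rewrite !sN IHx opprD.
Qed.

HB.instance Definition _ :=
  GRing.Zmodule_isLmodule.Build K tensor scaleA scale1 sD scaleDl.

Lemma scale_pure (c a : K) (m : M) : c *: pure a m = pure (c * a) m.
Proof. exact: sE. Qed.

End Module.

Section Bracket.
Variable M : lieRingType.
Implicit Types x y z : tensor M.

(* [a (x) m, b (x) n] = ab (x) [m, n], extended biadditively *)
Definition tensor_br_pure (a : K) (m : M) : tensor M -> tensor M :=
  tensor_lift (fun b n => pure (a * b) [!m, n]).
Definition tensor_br x y : tensor M :=
  tensor_lift (fun a m => tensor_br_pure a m y) x.

Let pDl a (m : M) b c (n : M) :
  pure (a * (b + c)) [!m, n] = pure (a * b) [!m, n] + pure (a * c) [!m, n].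
Proof. by rewrite mulrDr pureDl. Qed.
Let pDr a (m : M) b (n p : M) :
  pure (a * b) [!m, n + p] = pure (a * b) [!m, n] + pure (a * b) [!m, p].
Proof. by rewrite lbrDr pureDr. Qed.

Let pE a m b (n : M) : tensor_br_pure a m (pure b n) = pure (a * b) [!m, n].
Proof. exact: tensor_lift_pure. Qed.
Let p0 a m : tensor_br_pure a m 0 = 0. Proof. exact: tensor_lift0. Qed.
Let pD a m : {morph tensor_br_pure a m : x y / x + y}.
Proof. exact: tensor_liftD. Qed.
Let pN a m : {morph tensor_br_pure a m : x / - x}.
Proof. exact: tensor_liftN. Qed.

Let qDl y a b m :
  tensor_br_pure (a + b) m y = tensor_br_pure a m y + tensor_br_pure b m y.
Proof.
elim/tensor_ind: y => [c n||x y IHx IHy|x IHx].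
- by rewrite !pE mulrDl pureDl.
- by rewrite !p0 addr0.
- by rewrite !pD IHx IHy addrACA.
- by rewrite !pN IHx opprD.
Qed.
Let qDr y a m n :
  tensor_br_pure a (m + n) y = tensor_br_pure a m y + tensor_br_pure a n y.
Proof.
elim/tensor_ind: y => [c p||x y IHx IHy|x IHx].
- by rewrite !pE lbrDl pureDr.
- by rewrite !p0 addr0.
- by rewrite !pD IHx IHy addrACA.
- by rewrite !pN IHx opprD.
Qed.

Let brE a m y : tensor_br (pure a m) y = tensor_br_pure a m y.
Proof. exact: (tensor_lift_pure (qDl y) (qDr y)). Qed.
Let br0 y : tensor_br 0 y = 0.
Proof. exact: (tensor_lift0 (qDl y) (qDr y)). Qed.
Let brDl x y z : tensor_br (x + y) z = tensor_br x z + tensor_br y z.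
Proof. exact: (tensor_liftD (qDl z) (qDr z)). Qed.
Let brN x y : tensor_br (- x) y = - tensor_br x y.
Proof. exact: (tensor_liftN (qDl y) (qDr y)). Qed.

Let brDr x y z : tensor_br x (y + z) = tensor_br x y + tensor_br x z.
Proof.
elim/tensor_ind: x => [a m||x x' IHx IHx'|x IHx].
- by rewrite !brE pD.
- by rewrite !br0 addr0.
- by rewrite !brDl IHx IHx' addrACA.
- by rewrite !brN IHx opprD.
Qed.
Let br0r x : tensor_br x 0 = 0.
Proof. by apply: (addrI (tensor_br x 0)); rewrite -brDr !addr0. Qed.
Let brNr x y : tensor_br x (- y) = - tensor_br x y.
Proof. by apply: (addrI (tensor_br x y)); rewrite -brDr !subrr br0r. Qed.

Let brC x y : tensor_br x y = - tensor_br y x.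
Proof.
elim/tensor_ind: x => [a m||x x' IHx IHx'|x IHx].
- elim/tensor_ind: y => [b n||y y' IHy IHy'|y IHy].
  + by rewrite !brE !pE lbrC pureNr mulrC.
  + by rewrite br0 br0r oppr0.
  + by rewrite brDl brDr IHy IHy' opprD.
  + by rewrite brN brNr IHy.
- by rewrite br0 br0r oppr0.
- by rewrite brDl brDr IHx IHx' opprD.
- by rewrite brN brNr IHx.
Qed.

Let brxx x : tensor_br x x = 0.
Proof.
elim/tensor_ind: x => [a m||x y IHx IHy|x IHx].
- by rewrite brE pE lbrxx pure0r.
- exact: br0.
- by rewrite brDl !brDr IHx IHy (brC y x) add0r addr0 subrr.
- by rewrite brN brNr IHx !oppr0.
Qed.

Let brJ x y z :
  tensor_br x (tensor_br y z) + tensor_br y (tensor_br z x)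
    + tensor_br z (tensor_br x y) = 0.
Proof.
have sum3 (a b c a' b' c' : tensor M) : a + b + c = 0 -> a' + b' + c' = 0 ->
    (a + a') + (b + b') + (c + c') = 0.
  by move=> h h'; rewrite (addrACA a) (addrACA (a + b)) h h' addr0.
elim/tensor_ind: x => [a m||x x' IHx IHx'|x IHx].
- elim/tensor_ind: y => [b n||y y' IHy IHy'|y IHy].
  + elim/tensor_ind: z => [c p||z z' IHz IHz'|z IHz].
    * rewrite !(brE, pE) (mulrA b) (mulrC (b * c)) (mulrCA c) (mulrC c).
      by rewrite -!pureDr lbr_jacobi pure0r.
    * by rewrite !(br0, br0r) !addr0.
    * by rewrite !(brDl, brDr); apply: sum3.
    * by rewrite !(brN, brNr) -!opprD IHz oppr0.
  + by rewrite !(br0, br0r) !addr0.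
  + by rewrite !(brDl, brDr); apply: sum3.
  + by rewrite !(brN, brNr) -!opprD IHy oppr0.
- by rewrite !(br0, br0r) !addr0.
- by rewrite !(brDl, brDr); apply: sum3.
- by rewrite !(brN, brNr) -!opprD IHx oppr0.
Qed.

HB.instance Definition _ := Zmodule_isLieRing.Build (tensor M) brDl brDr brxx brJ.

Let brZl c x y : [!c *: x, y] = c *: [!x, y].
Proof.
rewrite -[LHS]/(tensor_br _ _) -[[!x, y]]/(tensor_br x y).
elim/tensor_ind: x => [a m||x x' IHx IHx'|x IHx].
- rewrite scale_pure !brE; elim/tensor_ind: y => [b n||y y' IHy IHy'|y IHy].
  + by rewrite !pE scale_pure mulrA.
  + by rewrite !p0 scaler0.
  + by rewrite !pD IHy IHy' scalerDr.
  + by rewrite !pN IHy scalerN.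
- by rewrite scaler0 br0 scaler0.
- by rewrite scalerDr !brDl IHx IHx' scalerDr.
- by rewrite scalerN !brN IHx scalerN.
Qed.
Let brZr c x y : [!x, c *: y] = c *: [!x, y].
Proof. by rewrite lbrC brZl -scalerN -lbrC. Qed.

HB.instance Definition _ :=
  LieRing_isLieAlgebra.Build K (tensor M) brZl brZr.

Lemma pure_br a b (m n : M) : [!pure a m, pure b n] = pure (a * b) [!m, n].
Proof. by rewrite -[LHS]/(tensor_br _ _) brE pE. Qed.

End Bracket.
End Tensor.

Inductive dynkin := TypeA of nat | TypeD of nat | TypeE of nat.

Definition dynkin_wf (G : dynkin) : bool :=
  match G with
  | TypeA n => (2 <= n)%N
  | TypeD n => (4 <= n)%N
  | TypeE n => (6 <= n <= 8)%N
  end.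

Definition dynkin_rank (G : dynkin) : nat :=
  match G with TypeA n | TypeD n | TypeE n => n end.

Definition vertex (G : dynkin) := 'I_(dynkin_rank G).

(* Edges i - j with i < j, the n vertices being numbered from 0:
   A_n is the chain 0 - ... - n-1; D_n and E_n are the chain 0 - ... - n-2
   together with the vertex n-1, attached to n-3 and to 2, respectively. *)
Definition dynkin_edge (G : dynkin) (i j : nat) : bool :=
  match G with
  | TypeA n => j == i.+1
  | TypeD n => (j == i.+1) && (j.+1 < n)%N || (i.+3 == n) && (j.+1 == n)
  | TypeE n => (j == i.+1) && (j.+1 < n)%N || (i == 2) && (j.+1 == n)
  end.

Definition adj (G : dynkin) : rel (vertex G) :=
  fun x y => dynkin_edge G x y || dynkin_edge G y x.

Definition cartan (G : dynkin) (x y : vertex G) : int :=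
  if x == y then 2 else if adj x y then -1 else 0.

Section L0.
Variables (K : comNzRingType) (G : dynkin).
Local Notation var := (free_lie_var K).

(* x and y are allowed to be equal below, where the relator is 0. *)
Definition nonadj_relators : set (free_lie K (vertex G)) :=
  [set r | exists x y, ~~ adj x y /\ r = [!var x, var y]].

Definition FLie : lieAlgType K := lie_quot nonadj_relators.
Definition FLie_gen (x : vertex G) : FLie := lie_quot_pi nonadj_relators (var x).

Definition sandwich_relators : set FLie :=
  [set r | exists x y, r = [!FLie_gen x, [!FLie_gen x, y]]].

Definition L0 : lieAlgType K := lie_quot sandwich_relators.
Definition L0_gen (x : vertex G) : L0 := lie_quot_pi sandwich_relators (FLie_gen x).

End L0.

Record chevalley_gens (C : fieldType) (gC : lieVectType C) (G : dynkin) := {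
  chE : vertex G -> gC;
  chH : vertex G -> gC;
  chF : vertex G -> gC;
  chHH : forall x y, [!chH x, chH y] = 0;
  chEF : forall x y, [!chE x, chF y] = if x == y then chH x else 0;
  chHE : forall x y, [!chH x, chE y] = (cartan x y)%:~R *: chE y;
  chHF : forall x y, [!chH x, chF y] = - (cartan x y)%:~R *: chF y;
  ch_gen : lie_gen (range chE `|` range chF) = [set: gC]
}.

Section Roots.
Variables (C : fieldType) (gC : lieVectType C) (G : dynkin).
Variable c : chevalley_gens gC G.

(* A linear functional on the span h of the H_x is encoded by its values on the
   H_x; this is faithful since the H_x form a basis of h. *)
Definition weight := {ffun vertex G -> C}.

Definition in_root_space (a : weight) (v : gC) : Prop :=
  forall x, [!chH c x, v] = a x *: v.

Definition is_root (a : weight) : Prop :=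
  a <> 0 /\ exists v, v <> 0 /\ in_root_space a v.

Definition simple_root (y : vertex G) : weight :=
  [ffun x => (cartan x y)%:~R].

(* p is the largest integer such that b - p a is a root. *)
Definition string_length (a b : weight) (p : nat) : Prop :=
  is_root (b - a *+ p) /\ forall q : nat, (p < q)%N -> ~ is_root (b - a *+ q).

Definition zspan (Phi : seq weight) (E : weight -> gC) : set gC :=
  [set v | exists (m : vertex G -> int) (n : weight -> int),
     v = \sum_x chH c x *~ m x + \sum_(a <- Phi) E a *~ n a].

(* cb_coroot says that [E_a, E_(-a)] is the coroot of a, i.e. the element of
   [g_a, g_(-a)] at which a takes the value 2.  cb_closed is Chevalley's theorem
   that the Z-span is a Lie ring; it is recorded here because the Lie ring
   structure of the Z-form is built from it. *)
Record chevalley_basis := {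
  cb_Phi : seq weight;
  cb_E : weight -> gC;
  cb_Phi_uniq : uniq cb_Phi;
  cb_PhiP : forall a, a \in cb_Phi <-> is_root a;
  cb_basis : basis_of fullv
    ([seq chH c x | x <- enum (vertex G)] ++ [seq cb_E a | a <- cb_Phi]);
  cb_root_space : forall a, a \in cb_Phi -> in_root_space a (cb_E a);
  cb_simple : forall x, cb_E (simple_root x) = chE c x;
  cb_opp_simple : forall x, cb_E (- simple_root x) = chF c x;
  cb_coroot : forall a, a \in cb_Phi ->
    [![!cb_E a, cb_E (- a)], cb_E a] = 2 *: cb_E a;
  cb_const : forall a b, a \in cb_Phi -> b \in cb_Phi -> a + b \in cb_Phi ->
    exists (s : bool) (p : nat), string_length a b p /\
      [!cb_E a, cb_E b] = (-1) ^+ s * p.+1%:R *: cb_E (a + b);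
  cb_closed : forall u v, zspan cb_Phi cb_E u -> zspan cb_Phi cb_E v ->
    zspan cb_Phi cb_E [!u, v]
}.

End Roots.

Section ChevalleyAlgebra.
Variables (C : numFieldType) (gC : lieVectType C) (G : dynkin).
Variables (c : chevalley_gens gC G) (B : chevalley_basis c).

Definition zform_pred : pred gC := fun v => `[< zspan c (cb_Phi B) (cb_E B) v >].

Lemma zform_zmod : zmod_closed zform_pred.
Proof.
split.
  apply/asboolP; exists (fun=> 0), (fun=> 0).
  by rewrite !big1 ?addr0 // => *; rewrite mulr0z.
move=> u v /asboolP[m [n ->]] /asboolP[m' [n' ->]]; apply/asboolP.
exists (fun x => m x - m' x), (fun a => n a - n' a).
rewrite opprD addrACA -!sumrB.
by congr (_ + _); apply: eq_bigr => i _; rewrite mulrzBr.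
Qed.
HB.instance Definition _ := GRing.isZmodClosed.Build gC zform_pred zform_zmod.

Record zform : Type := ZForm {
  zform_val :> gC;
  zform_valP : zform_pred zform_val
}.
HB.instance Definition _ := [isSub for zform_val].
HB.instance Definition _ := [Choice of zform by <:].
HB.instance Definition _ := [SubChoice_isSubZmodule of zform by <:].

Lemma zform_brP (x y : zform) : zform_pred [!val x, val y].
Proof.
exact: (asboolT (cb_closed (asboolW (valP x)) (asboolW (valP y)))).
Qed.
Definition zform_br (x y : zform) : zform := ZForm (zform_brP x y).

Let v := zform_val.
Let vD x y : v (x + y) = v x + v y. Proof. exact: (raddfD val). Qed.
Let v0 : v 0 = 0. Proof. exact: (raddf0 val). Qed.
Let vB x y : v (zform_br x y) = [!v x, v y]. Proof. by []. Qed.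

Let brDl (x y z : zform) : zform_br (x + y) z = zform_br x z + zform_br y z.
Proof. by apply: val_inj; rewrite -[LHS]/(v _) -[RHS]/(v _) !(vB, vD) lbrDl. Qed.
Let brDr (x y z : zform) : zform_br x (y + z) = zform_br x y + zform_br x z.
Proof. by apply: val_inj; rewrite -[LHS]/(v _) -[RHS]/(v _) !(vB, vD) lbrDr. Qed.
Let brxx (x : zform) : zform_br x x = 0.
Proof. by apply: val_inj; rewrite -[LHS]/(v _) -[RHS]/(v _) vB v0 lbrxx. Qed.
Let brJ (x y z : zform) :
  zform_br x (zform_br y z) + zform_br y (zform_br z x)
    + zform_br z (zform_br x y) = 0.
Proof.
by apply: val_inj; rewrite -[LHS]/(v _) -[RHS]/(v _) !(vD, vB) v0 lbr_jacobi.
Qed.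
HB.instance Definition _ := Zmodule_isLieRing.Build zform brDl brDr brxx brJ.

Lemma zform_chE x : zform_pred (chE c x).
Proof.
apply/asboolP; have [E0|E0] := eqVneq (chE c x) 0.
  exists (fun=> 0), (fun=> 0).
  by rewrite E0 !big1 ?addr0 // => *; rewrite mulr0z.
have rx : simple_root C x \in cb_Phi B.
  apply/(cb_PhiP B); split.
    move/ffunP/(_ x); rewrite !ffunE /cartan eqxx => /eqP.
    by rewrite intr_eq0.
  exists (chE c x); split; first exact/eqP.
  by move=> y; rewrite chHE ffunE.
exists (fun=> 0), (fun a => (a == simple_root C x)%:Z).
rewrite big1 ?add0r; last by move=> *; rewrite mulr0z.
rewrite (bigD1_seq (simple_root C x)) ?cb_Phi_uniq //= eqxx mulr1z.
rewrite big1 ?addr0 ?cb_simple // => a /negPf->.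
by rewrite mulr0z.
Qed.
Definition zform_E (x : vertex G) : zform := ZForm (zform_chE x).

Variable K : comNzRingType.

Definition chevalley_algebra : lieAlgType K := tensor K zform.
Definition chE0 (x : vertex G) : chevalley_algebra := pure 1 (zform_E x).

Definition n_plus : lieAlgType K := sub_lie (range chE0).
Definition n_plus_E (x : vertex G) : n_plus :=
  SubLie (mem_lie_gen (imageT chE0 x)).

End ChevalleyAlgebra.

(* Main.v *)
Require Import Defs.
From mathcomp Require Import all_boot all_order all_algebra.
From mathcomp Require Import boolp classical_sets reals.
From mathcomp Require Import complex.
From mathcomp Require Import zify ring.

(** A word x1 ... xk of vertices stands for the bracket [e_x1, [e_x2, ... e_xk]], and
    its weight is the sum of the simple roots of its letters. A word is good when each
    letter x is followed by a suffix of weight b with <b, x> = -1; the weights of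
    its suffixes then climb through roots, that is, vectors of norm 2, one simple root
    at a time. All that is used of the root system is that the Cartan form is positive
    definite (bform_gt0): it forces <b, x> to be -1, 0 or 1 for the weight b of a good
    word other than x itself (pairing_good).

    L(0) is not too large. As soon as generators at nonadjacent vertices commute, a
    letter x with <wt w, x> = 1 can be moved to the front of a good word w without
    changing its bracket, up to sign (br_move_front), so that good words of the same
    weight have the same bracket up to sign (br_wt_inj). If moreover the generators are
    sandwiches and 2 is invertible, then [e_x, [u, [e_x, v]]] = 0 as well (sandwich2),
    and bracketing with e_x kills every good bracket with <wt w, x> >= 0
    (sandwich_br_eq0); when <wt w, x> = -1 it gives a longer good bracket. So the
    good brackets span L(0) (L0_spanned), and one word for each weight suffices.

    n_+ is not too small. In the complex simple Lie algebra, a weight vector of height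
    at least 2 killed by all F_y would generate a proper ideal, hence is 0
    (lowering_eq0). With this in place of the sandwich property the same induction
    applies (raise_br_eq0), and it also shows how the F_y lower good brackets
    (lower_br, lower_br_eq0). Hence good brackets are not 0, and the algebra is spanned
    by the H_x and the good brackets in the E_x and in the F_x, so that no root has norm
    more than 2 (is_root_norm). Adding a simple root inside the root system therefore always
    happens at the bottom of a root string, the structure constants involved are 1 or
    -1, and each good bracket is plus or minus a vector of the Chevalley basis
    (br_chE_basis).

    These facts hold in the Z-form, hence over K. So n_+ satisfies the relations of
    L(0), which gives the homomorphism (L0_to_n_plus), and coordinates on the Chevalley
    basis recover an element of L(0) from its image (L0_to_n_plus_inj). *)

Import Order.TTheory GRing.Theory Num.Theory.
Local Open Scope ring_scope.

Set Implicit Arguments.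
Unset Strict Implicit.
Unset Printing Implicit Defensive.

(** * The Cartan form is positive definite *)

Section RootLattice.
Variable G : dynkin.
Implicit Types (b g : {ffun vertex G -> int}) (x y : vertex G).

Definition alpha x : {ffun vertex G -> int} := [ffun y => (y == x)%:Z].
Definition pairing b x : int := \sum_y cartan x y * b y.
Definition bform b g : int := \sum_x b x * pairing g x.

Lemma adjC x y : adj x y = adj y x.
Proof. by rewrite /adj orbC. Qed.

Lemma cartanC x y : cartan x y = cartan y x.
Proof. by rewrite /cartan eq_sym adjC. Qed.

Lemma cartanxx x : cartan x x = 2.
Proof. by rewrite /cartan eqxx. Qed.

Lemma cartan_neq x y : x != y -> cartan x y = - (adj x y)%:Z.
Proof. by rewrite /cartan => /negPf->; case: adj. Qed.

Lemma pairingD b g x : pairing (b + g) x = pairing b x + pairing g x.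
Proof. by rewrite -big_split; apply: eq_bigr => y _; rewrite ffunE mulrDr. Qed.

Lemma pairingN b x : pairing (- b) x = - pairing b x.
Proof. by rewrite -sumrN; apply: eq_bigr => y _; rewrite ffunE mulrN. Qed.

Lemma pairing_alpha x y : pairing (alpha y) x = cartan x y.
Proof.
rewrite /pairing (bigD1 y) //= ffunE eqxx mulr1 big1 ?addr0 // => z /negPf zy.
by rewrite ffunE zy mulr0.
Qed.

Lemma bformC b g : bform b g = bform g b.
Proof.
rewrite /bform /pairing.
under eq_bigr do rewrite mulr_sumr.
under [RHS]eq_bigr do rewrite mulr_sumr.
rewrite exchange_big; apply: eq_bigr => x _; apply: eq_bigr => y _.
by rewrite cartanC; ring.
Qed.

Lemma bformDr b g g' : bform b (g + g') = bform b g + bform b g'.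
Proof. by rewrite -big_split; apply: eq_bigr => x _; rewrite pairingD mulrDr. Qed.

Lemma bformNr b g : bform b (- g) = - bform b g.
Proof. by rewrite -sumrN; apply: eq_bigr => x _; rewrite pairingN mulrN. Qed.

Lemma bformDl b b' g : bform (b + b') g = bform b g + bform b' g.
Proof. by rewrite bformC bformDr !(bformC g). Qed.

Lemma bformNl b g : bform (- b) g = - bform b g.
Proof. by rewrite bformC bformNr (bformC g). Qed.

Lemma bform_alphal b x : bform (alpha x) b = pairing b x.
Proof.
rewrite /bform (bigD1 x) //= ffunE eqxx mul1r big1 ?addr0 // => z /negPf zy.
by rewrite ffunE zy mul0r.
Qed.

Lemma bform_alphar b x : bform b (alpha x) = pairing b x.
Proof. by rewrite bformC bform_alphal. Qed.

Lemma bform0l g : bform 0 g = 0.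
Proof. by rewrite /bform big1 // => x _; rewrite ffunE mul0r. Qed.

(** If a positive vector u has positive image under the Cartan matrix C, then with
    b = u t one gets
    (b, b) = sum_x u_x (C u)_x t_x ^ 2 - 1/2 sum_(x, y) C_xy u_x u_y (t_x - t_y) ^ 2,
    whose terms are all nonnegative as C_xy <= 0 off the diagonal. *)
Lemma bform_gt0_of_dominant (u : {ffun vertex G -> int}) :
  (forall x, 0 < u x) -> (forall x, 0 < pairing u x) ->
  forall b, b != 0 -> 0 < bform b b.
Proof.
move=> u0 Cu0 b bn0.
pose U x : rat := (u x)%:~R; pose t x : rat := (b x)%:~R / U x.
pose C x y : rat := (cartan x y)%:~R.
have U0 x : 0 < U x by rewrite ltr0z.
have bE x : (b x)%:~R = U x * t x by rewrite /t mulrC divfK ?gt_eqF.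
suff: 0 < (bform b b)%:~R :> rat by rewrite ltr0z.
have -> : (bform b b)%:~R = \sum_x \sum_y C x y * U x * U y * (t x * t y) :> rat.
  rewrite /bform /pairing rmorph_sum; apply: eq_bigr => x _.
  rewrite rmorphM rmorph_sum mulr_sumr; apply: eq_bigr => y _.
  by rewrite rmorphM /= !bE /C; ring.
have split2 x y : C x y * U x * U y * (t x * t y) =
    2^-1 * (C x y * U x * U y * t x ^+ 2) + 2^-1 * (C x y * U x * U y * t y ^+ 2)
    + - (2^-1 * (C x y * U x * U y * (t x - t y) ^+ 2)) by field.
under eq_bigr do under eq_bigr do rewrite split2.
under eq_bigr do rewrite 2!big_split /=.
rewrite 2!big_split /= [X in _ + X + _]exchange_big /=.
have -> : \sum_x \sum_y 2^-1 * (C y x * U y * U x * t x ^+ 2) =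
          \sum_x \sum_y 2^-1 * (C x y * U x * U y * t x ^+ 2).
  apply: eq_bigr => x _; apply: eq_bigr => y _.
  by rewrite /C cartanC; ring.
rewrite -big_split /=.
have -> : \sum_x (\sum_y 2^-1 * (C x y * U x * U y * t x ^+ 2) +
                  \sum_y 2^-1 * (C x y * U x * U y * t x ^+ 2)) =
          \sum_x U x * (pairing u x)%:~R * t x ^+ 2.
  apply: eq_bigr => x _; rewrite -big_split /= /pairing rmorph_sum mulr_sumr.
  rewrite mulr_suml; apply: eq_bigr => y _; rewrite rmorphM /= -/(C x y) -/(U y).
  by field.
have [x bx] : exists x, b x != 0.
  apply/existsP; apply: contraNT bn0 => /existsPn h.
  by apply/eqP/ffunP => x; rewrite ffunE; apply/eqP; rewrite -[_ == _]negbK h.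
apply: ltr_wpDr.
  apply: sumr_ge0 => y _; apply: sumr_ge0 => z _.
  have [->|yz] := eqVneq y z; first by rewrite subrr expr0n !mulr0 oppr0.
  rewrite /C (cartan_neq yz) rmorphN !mulNr mulrN opprK.
  rewrite mulr_ge0 ?invr_ge0 // mulr_ge0 ?sqr_ge0 //.
  by rewrite !mulr_ge0 ?(ltW (U0 _)) ?ler0z ?le0z_nat.
rewrite (bigD1 x) //=; apply: ltr_wpDr.
  by apply: sumr_ge0 => y _; rewrite mulr_ge0 ?sqr_ge0 ?mulr_ge0 ?ler0z ?ltW.
apply: mulr_gt0; first by rewrite mulr_gt0 ?ltr0z.
rewrite exprn_even_gt0 //=.
apply: mulf_neq0; first by rewrite intr_eq0.
by rewrite invr_neq0 // gt_eqF.
Qed.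

Lemma pairing_adj b x :
  pairing b x = 2 * b x - \sum_(y | adj x y && (y != x)) b y.
Proof.
rewrite /pairing (bigD1 x) //= cartanxx; congr (_ + _).
rewrite -sumrN [RHS]big_mkcond [LHS]big_mkcond /=.
apply: eq_bigr => y _; case: eqVneq => [->|yx] /=; first by rewrite andbF.
rewrite andbT cartan_neq 1?eq_sym //.
by case: adj; rewrite ?mulN1r ?mul0r ?oppr0 //.
Qed.

End RootLattice.


(** A multiple of the sum of the positive roots, in the basis of simple roots: every
    simple root pairs positively with it. *)
Definition dominant_coord (G : dynkin) (i : nat) : int :=
  match G with
  | TypeA n => (i%:Z + 1) * (n%:Z - i%:Z)
  | TypeD n => if (i.+2 < n)%N then 2 * (i%:Z + 1) * (2 * n%:Z - 2 - i%:Z)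
               else n%:Z * (n%:Z - 1)
  | TypeE 6 => [:: 16; 30; 42; 30; 16; 22]`_i
  | TypeE 7 => [:: 34; 66; 96; 75; 52; 27; 49]`_i
  | TypeE _ => [:: 92; 182; 270; 220; 168; 114; 58; 136]`_i
  end.

Lemma sum_ord_le_seq n (P : pred 'I_n) (f : nat -> int) (s : seq nat) :
    (forall k, k \in s -> 0 <= f k) -> (forall y, P y -> val y \in s) ->
  \sum_(y | P y) f y <= \sum_(k <- s) f k.
Proof.
elim: s P => [|k s IHs] P f0 Ps.
  by rewrite big_nil big_pred0 // => y; apply/negP => /Ps.
rewrite big_cons (bigID (fun y : 'I_n => val y == k)) /=; apply: lerD; last first.
  apply: IHs => [j js|y /andP[Py yk]]; first by rewrite f0 // inE js orbT.
  by move: (Ps _ Py); rewrite inE (negPf yk).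
have [/existsP[y0 /eqP y0k]|/existsPn no] := boolP [exists y : 'I_n, val y == k].
  rewrite -{2}y0k (big_mkcondl) /= (bigD1 y0) ?y0k //= big1 ?addr0.
    by case: ifP => // _; rewrite f0 // inE eqxx.
  by move=> y /andP[/eqP yk /eqP []]; apply/val_inj; rewrite -y0k in yk.
rewrite big_pred0 ?f0 ?inE ?eqxx // => y.
by rewrite (negPf (no y)) andbF.
Qed.

Lemma dominant_coord_gt0 G (i : vertex G) : dynkin_wf G -> 0 < dominant_coord G i.
Proof.
case: i; case: G => n i /= lt_in wf.
- rewrite mulr_gt0 //; lia.
- case: ifP => h; rewrite ?mulr_gt0 //; lia.
- have {wf} : [|| n == 6, n == 7 | n == 8]%N by lia.
  by case/or3P=> /eqP E; move: i lt_in; rewrite E => -[|[|[|[|[|[|[|[|k]]]]]]]].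
Qed.

Lemma dominant_pairing_gt0 G (x : vertex G) : dynkin_wf G ->
  0 < pairing [ffun y : vertex G => dominant_coord G y] x.
Proof.
move=> wf; rewrite pairing_adj subr_gt0 ffunE.
under eq_bigr do rewrite ffunE.
case: x; case: G wf => n /= wf x lt_xn.
-   pose s := if x == 0 :> nat then [:: 1%N] else [:: x.-1; x.+1].
  apply: (@le_lt_trans _ _ (\sum_(k <- s) dominant_coord (TypeA n) k)).
    apply: sum_ord_le_seq.
    + move=> k; rewrite /s; case: ifP => _; rewrite !inE => kx; rewrite /=.
      by rewrite mulr_ge0 //; lia.
    by rewrite mulr_ge0 //; lia.
    + case=> y ly; rewrite /adj /= => /andP[h _].
      by rewrite /s; case: ifP => x0; rewrite !inE /=; lia.
  rewrite /s; case: eqP => x0; rewrite !big_cons big_nil /= ?x0; nia.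
- pose s := if x == 0 :> nat then [:: 1%N] else if (x.+3 < n)%N then [:: x.-1; x.+1]
    else if (x.+3 == n)%N then [:: x.-1; x.+1; x.+2] else [:: (n - 3)%N].
  apply: (@le_lt_trans _ _ (\sum_(k <- s) dominant_coord (TypeD n) k)).
    apply: sum_ord_le_seq.
    + move=> k; rewrite /s; do !case: ifP => ?; rewrite !inE => kx /=;
      case: ifP => ?; rewrite ?mulr_ge0 //; lia.
    + case=> y ly; rewrite /adj /= -val_eqE /= => /andP[h yx].
      by rewrite /s; do !case: ifP => ?; rewrite !inE /=; lia.
  rewrite /s; case: eqP => x0.
      rewrite big_seq1 /= x0; do !case: ifP => ?; nia.
    case: ifP => h1; first by rewrite !big_cons big_nil /=; do !case: ifP => ?; nia.
    case: ifP => h2; first by rewrite !big_cons big_nil /=; do !case: ifP => ?; nia.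
    by rewrite big_seq1 /=; do !case: ifP => ?; nia.
- have {wf} : [|| n == 6, n == 7 | n == 8]%N by lia.
  by case/or3P=> /eqP E; subst n; rewrite big_mkcond /= !big_ord_recl big_ord0 /=;
    case: x lt_xn => [|[|[|[|[|[|[|[|k]]]]]]]] lt_k.
Qed.

Theorem bform_gt0 G (b : {ffun vertex G -> int}) :
  dynkin_wf G -> b != 0 -> 0 < bform b b.
Proof.
move=> wf; apply: (bform_gt0_of_dominant (u := [ffun y : vertex G => dominant_coord G y])).
  by move=> x; rewrite ffunE dominant_coord_gt0.
by move=> x; apply: dominant_pairing_gt0.
Qed.

(** * Good words and their brackets *)

Section GoodWords.
Variable G : dynkin.
Implicit Types (w : seq (vertex G)) (x y : vertex G).
Implicit Types (b : {ffun vertex G -> int}).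

Definition wt w : {ffun vertex G -> int} := \sum_(x <- w) alpha x.

(** The bracket of the empty word is meaningless, so only nonempty words are good. *)
Fixpoint good w : bool :=
  if w is x :: w' then (w' == [::]) || good w' && (pairing (wt w') x == -1)
  else false.

Lemma wt_cons x w : wt (x :: w) = alpha x + wt w.
Proof. exact: big_cons. Qed.

Lemma wt1 x : wt [:: x] = alpha x.
Proof. exact: big_seq1. Qed.

Lemma pairing_cons x w y : pairing (wt (x :: w)) y = cartan y x + pairing (wt w) y.
Proof. by rewrite wt_cons pairingD pairing_alpha. Qed.

Lemma good_cons x w : good w -> pairing (wt w) x = -1 -> good (x :: w).
Proof. by move=> /= -> ->; rewrite orbT. Qed.

Lemma goodP w : good w ->
  (exists x, w = [:: x]) \/
  exists x w', [/\ w = x :: w', good w' & pairing (wt w') x = -1].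
Proof.
case: w => // x [|y w]; first by left; exists x.
by move=> /= /andP[gw /eqP pw]; right; exists x, (y :: w).
Qed.

Lemma sum_wt w : \sum_x wt w x = (size w)%:Z.
Proof.
elim: w => [|x w IHw]; first by rewrite /wt big_nil big1 // => x _; rewrite ffunE.
rewrite wt_cons /=; under eq_bigr do rewrite ffunE.
rewrite big_split /= IHw (bigD1 x) //= big1 => [|y /negPf yx]; rewrite ffunE ?yx //.
by rewrite eqxx addr0; lia.
Qed.

Lemma norm_good w : good w -> bform (wt w) (wt w) = 2.
Proof.
elim: w => // x w IHw /= /orP[/eqP->|/andP[gw /eqP pw]].
  by rewrite wt1 bform_alphal pairing_alpha cartanxx.
rewrite wt_cons bformDr !bformDl !bform_alphal !bform_alphar pairing_alpha cartanxx.
by rewrite IHw // pw.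
Qed.

Lemma norm_sub_alpha b x p :
  bform (b - alpha x *+ p) (b - alpha x *+ p) =
  bform b b - 2 * p%:Z * pairing b x + 2 * p%:Z ^+ 2.
Proof.
have pmul q : pairing (alpha x *+ q) x = 2 * q%:Z.
  elim: q => [|q IHq]; first by rewrite mulr0n -bform_alphal bformC bform0l.
  by rewrite mulrSr pairingD IHq pairing_alpha cartanxx; lia.
have bmul q c : bform (alpha x *+ q) c = q%:Z * pairing c x.
  elim: q => [|q IHq]; first by rewrite mulr0n bform0l mul0r.
  by rewrite mulrSr bformDl IHq bform_alphal -addn1 PoszD; ring.
rewrite bformDr !bformDl !bformNr !bformNl (bformC b) !bmul pmul; ring.
Qed.

Hypothesis wfG : dynkin_wf G.

Lemma norm_ge0 b : 0 <= bform b b.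
Proof. by have [->|/bform_gt0/ltW->//] := eqVneq b 0; rewrite bform0l. Qed.

Lemma norm_eq0 b : bform b b = 0 -> b = 0.
Proof. by move=> h; have [//|/(bform_gt0 wfG)] := eqVneq b 0; rewrite h ltxx. Qed.

Lemma pairing_good_le2 w x : good w -> pairing (wt w) x <= 2.
Proof.
move=> /norm_good h; have := norm_ge0 (wt w - alpha x *+ 1).
by rewrite norm_sub_alpha h; lia.
Qed.

(** By Cauchy-Schwarz the weight is alpha x, and its height is the size of the word. *)
Lemma pairing_good_eq2 w x : good w -> pairing (wt w) x = 2 -> w = [:: x].
Proof.
move=> gw px; have wx : wt w = alpha x.
  apply/eqP; rewrite -subr_eq0; apply/eqP/norm_eq0.
  by rewrite -[alpha x]mulr1n norm_sub_alpha norm_good // px; lia.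
have := sum_wt w; rewrite wx -wt1 sum_wt => -[]; case: w gw wx {px} => [|y[]] // _.
rewrite wt1 => /ffunP/(_ y); rewrite !ffunE eqxx.
by case: eqP => // ->.
Qed.

Lemma wt_neq0 w : w != [::] -> wt w != 0.
Proof.
apply: contraNneq => w0; have := sum_wt w; rewrite w0 big1 => [|x _].
  by case: w {w0}.
by rewrite ffunE.
Qed.

Lemma pairing_good_ge w x : good w -> -1 <= pairing (wt w) x.
Proof.
move=> /norm_good h; have := bform_gt0 wfG (@wt_neq0 (x :: w) isT).
rewrite wt_cons bformDr !bformDl !bform_alphal !bform_alphar pairing_alpha cartanxx h.
by lia.
Qed.

(** Two vectors of norm 2 have a product between -2 and 2, and 2 and -2 are reached only
    if they are equal, or opposite; the latter is impossible for sums of simple roots. *)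
Lemma pairing_good w x : good w ->
  [\/ pairing (wt w) x = -1, pairing (wt w) x = 0, pairing (wt w) x = 1 | w = [:: x]].
Proof.
move=> gw; have h1 := pairing_good_ge x gw; have h2 := pairing_good_le2 x gw.
have [/(pairing_good_eq2 gw)->|h3] := pairing (wt w) x =P 2; first by constructor 4.
have [->|h4] := pairing (wt w) x =P -1; first by constructor 1.
have [->|h5] := pairing (wt w) x =P 0; first by constructor 2.
by constructor 3; lia.
Qed.

Lemma adj_neq x y : adj x y -> x != y.
Proof.
apply: contraTneq => ->; rewrite /adj orbb.
case: y; case: G wfG => n /= wf y _; lia.
Qed.

Lemma cartan_adj x y : adj x y -> cartan x y = -1.
Proof. by move=> a; rewrite cartan_neq ?adj_neq // a. Qed.

Lemma cartan_nadj x y : x != y -> ~~ adj x y -> cartan x y = 0.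
Proof. by move=> xy /negPf a; rewrite cartan_neq // a. Qed.

Section Brackets.
Variables (L : lieRingType) (e : vertex G -> L).

Fixpoint br w : L :=
  match w with
  | [::] => 0
  | [:: x] => e x
  | x :: w' => [!e x, br w']
  end.

Lemma br_cons x w : good w -> br (x :: w) = [!e x, br w].
Proof. by case: w. Qed.

(** Equality up to sign, over Lie rings without scalars: this covers the Z-form. *)
Definition eq_sign (u v : L) := u = v \/ u = - v.

Lemma eq_sign_trans v u t : eq_sign u v -> eq_sign v t -> eq_sign u t.
Proof. by move=> [->|->] [->|->]; rewrite /eq_sign ?opprK; tauto. Qed.

Lemma eq_sign_brr z u v : eq_sign u v -> eq_sign [!z, u] [!z, v].
Proof. by case=> ->; rewrite ?lbrNr; [left|right]. Qed.

Lemma eq_sign0 u : eq_sign u 0 -> u = 0.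
Proof. by case=> ->; rewrite ?oppr0. Qed.

Lemma jacobiE (x y z : L) : [!x, [!y, z]] = [![!x, y], z] + [!y, [!x, z]].
Proof.
have := lbr_jacobi x y z.
rewrite (lbrC z x) lbrNr (lbrC z [!x, y]) => /eqP.
by rewrite -addrA -opprD subr_eq0 addrC => /eqP.
Qed.

Hypothesis commE : forall x y, x != y -> ~~ adj x y -> [!e x, e y] = 0.

(** Say w = y w' with y <> x. If x and y are not adjacent, then x can be moved to the
    front of w' and commutes with e_y. If they are, then <wt w', x> = 2, which leaves
    only w = y x, whose bracket is minus that of x y. *)
Lemma br_move_front w x : good w -> pairing (wt w) x = 1 ->
  exists w', [/\ good w', pairing (wt w') x = -1, wt (x :: w') = wt w
    & eq_sign (br w) (br (x :: w'))].
Proof.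
elim: w => // y w IHw gyw; have [[z [-> ->]]|[_ [_ [[<- <-] gw pw]]]] := goodP gyw.
  by rewrite wt1 pairing_alpha /cartan; case: eqP => // _; case: adj.
rewrite pairing_cons; have [->|yx] := eqVneq y x.
  by rewrite cartanxx => h; exists w; split=> //; [lia|left].
have [a|na] := boolP (adj x y); last first.
  rewrite cartan_nadj 1?eq_sym // add0r => px.
  have [w3 [gw3 pw3 wt3 e3]] := IHw gw px.
  have p3 : pairing (wt w3) y = -1.
    move: pw; rewrite -wt3 pairing_cons cartan_nadj ?add0r //.
    by rewrite adjC.
  exists (y :: w3); split.
  - exact: good_cons.
  - by rewrite pairing_cons cartan_nadj 1?eq_sym // add0r.
  - by rewrite !wt_cons -wt3 wt_cons addrCA.
  - have g3 := good_cons gw3 p3.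
    rewrite !br_cons // jacobiE commE 1?eq_sym // lbr0l add0r.
    rewrite br_cons // in e3.
    exact: eq_sign_brr.
rewrite cartan_adj // => h; have px : pairing (wt w) x = 2 by lia.
rewrite (pairing_good_eq2 gw px); exists [:: y]; split=> //.
- by rewrite wt1 pairing_alpha cartan_adj.
- by rewrite !wt_cons addrCA.
- by right; rewrite /= lbrC.
Qed.

(** The first letter of w' can be moved to the front of w; remove it from both. *)
Lemma br_wt_inj w w' : good w -> good w' -> wt w = wt w' -> eq_sign (br w) (br w').
Proof.
elim: w' w => // x w' IHw' w gw gxw'.
have [[z [-> ->]]|[_ [_ [[<- <-] gw' pw']]]] := goodP gxw'.
  move=> e1; suff -> : w = [:: z] by left.
  by apply: pairing_good_eq2 => //; rewrite e1 wt1 pairing_alpha cartanxx.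
move=> e1; have px : pairing (wt w) x = 1 by rewrite e1 pairing_cons cartanxx pw'.
have [w3 [gw3 pw3 wt3 e3]] := br_move_front gw px.
apply: eq_sign_trans e3 _; rewrite !br_cons //; apply: eq_sign_brr.
by apply: IHw' => //; apply: (addrI (alpha x)); rewrite -!wt_cons wt3.
Qed.

End Brackets.
End GoodWords.

(** * Sandwich generators *)

Section Sandwich.
Variables (L : lieRingType) (x : L).
Hypothesis two_inj : forall u : L, u *+ 2 = 0 -> u = 0.
Hypothesis xx0 : forall u, [!x, [!x, u]] = 0.

(** Expanding [[x, [x, u]], v] = 0 by the Jacobi identity leaves -2 [x, [u, [x, v]]]. *)
Lemma sandwich2 u v : [!x, [!u, [!x, v]]] = 0.
Proof.
have h : [![!x, [!x, u]], v] = 0 by rewrite xx0 lbr0l.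
have brA (a b c : L) : [![!a, b], c] = [!a, [!b, c]] - [!b, [!a, c]].
  by rewrite (jacobiE a b c) addrK.
apply: two_inj; apply: oppr_inj; rewrite oppr0 -[RHS]h brA.
rewrite (brA x u v) lbrDr lbrNr xx0 brA xx0 lbr0r.
by rewrite sub0r subr0 mulr2n opprD.
Qed.

End Sandwich.

Section SandwichWords.
Variables (G : dynkin) (L : lieRingType) (e : vertex G -> L).
Hypothesis wfG : dynkin_wf G.
Hypothesis two_inj : forall u : L, u *+ 2 = 0 -> u = 0.
Hypothesis commE : forall x y, x != y -> ~~ adj x y -> [!e x, e y] = 0.
Hypothesis sandwichE : forall x u, [!e x, [!e x, u]] = 0.

(** If <wt w, x> = 1, then x can be moved to the front of w and the sandwich property
    applies. If <wt w, x> = 0 and w = y w' with y adjacent to x, then <wt w', x> = 1, so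
    that the bracket has the form [e_x, [e_y, [e_x, v]]]. *)
Lemma sandwich_br_eq0 w x : good w -> 0 <= pairing (wt w) x -> [!e x, br e w] = 0.
Proof.
elim: w => // y w IHw gyw px.
have [[z [_ w0]]|[_ [_ [[<- <-] gw pw]]]] := goodP gyw.
  move: px; rewrite w0 wt1 pairing_alpha /=.
  have [->|yx] := eqVneq x y; first by rewrite lbrxx.
  by have [/(cartan_adj wfG)->|/commE->] := boolP (adj x y).
have [h|h|h|[yx w0]] := pairing_good wfG x gyw.
- by rewrite h in px.
- have yx : x != y.
    by apply: contra_eq_neq h => ->; rewrite pairing_cons cartanxx pw.
  rewrite br_cons //; move: h; rewrite pairing_cons.
  have [a|na] := boolP (adj x y).
    rewrite cartan_adj // => h; have {}h : pairing (wt w) x = 1 by lia.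
    have [w3 [gw3 _ _ [->|->]]] := br_move_front wfG commE gw h.
      by rewrite br_cons // sandwich2.
    by rewrite br_cons // !lbrNr sandwich2 ?oppr0.
  by rewrite cartan_nadj // add0r jacobiE commE // lbr0l add0r => h;
    rewrite IHw ?h ?lbr0r.
- have [w3 [gw3 _ _ [->|->]]] := br_move_front wfG commE gyw h.
    by rewrite br_cons // sandwichE.
  by rewrite br_cons // lbrNr sandwichE oppr0.
- by rewrite yx w0 /= lbrxx.
Qed.

End SandwichWords.

(** * Linear spans and generated subalgebras *)

Section Span.
Variables (R : comNzRingType) (L : lieAlgType R).
Implicit Types (X S V : set L).

Definition lin_closed V :=
  [/\ V 0, forall u v, V u -> V v -> V (u + v) & forall (c : R) u, V u -> V (c *: u)].

Definition lspan X : set L := smallest lin_closed X.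

Lemma lspan_closed X : lin_closed (lspan X).
Proof.
split=> [A [[]] //|u v hu hv A [hA XA]|c u hu A [hA XA]]; case: (hA) => _ hD hZ.
  by apply: hD; [apply: hu|apply: hv].
by apply: hZ; apply: hu.
Qed.

Lemma lspan_sub X V : lin_closed V -> (forall u, X u -> V u) -> forall u, lspan X u -> V u.
Proof. by move=> hV XV u; apply. Qed.

Lemma mem_lspan X u : X u -> lspan X u.
Proof. by move=> Xu A [_]; apply. Qed.

Lemma lspan_eq_sign X u v : eq_sign u v -> lspan X v -> lspan X u.
Proof.
have [_ _ hZ] := lspan_closed X.
by case=> -> // Xv; rewrite -scaleN1r; apply: hZ.
Qed.

Lemma lspan_lbr X x : (forall u, X u -> lspan X [!x, u]) ->
  forall u, lspan X u -> lspan X [!x, u].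
Proof.
have [h0 hD hZ] := lspan_closed X.
move=> h u; apply: (lspan_sub (V := [set u | lspan X [!x, u]]%classic)) => //.
split=> [|a b|c a] /=; first by rewrite lbr0r.
  by rewrite lbrDr; apply: hD.
by rewrite lbrZr; apply: hZ.
Qed.

(** The elements whose bracket preserves V form a subalgebra. *)
Lemma lie_gen_sub_lbr S V : lin_closed V ->
    (forall s v, S s -> V v -> V [!s, v]) ->
  forall u v, lie_gen S u -> V v -> V [!u, v].
Proof.
move=> [V0 VD VZ] SV u v Su; move: v.
pose A := [set u | forall v, V v -> V [!u, v]]%classic; rewrite -/(A u).
apply: (Su A); split=> [|s Ss v Vv]; last exact: SV.
split=> [v Vv|a b ha hb v Vv|c a ha v Vv|a b ha hb v Vv].
- by rewrite lbr0l.
- by rewrite lbrDl; apply: VD; [apply: ha|apply: hb].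
- by rewrite lbrZl; apply/VZ/ha.
have -> : [![!a, b], v] = [!a, [!b, v]] + (-1) *: [!b, [!a, v]].
  by rewrite (jacobiE a b) scaleN1r addrK.
by apply: VD; [apply/ha/hb|apply/VZ/hb/ha].
Qed.

Lemma lie_gen_sub S V : lin_closed V -> (forall s, S s -> V s) ->
    (forall s v, S s -> V v -> V [!s, v]) ->
  forall u, lie_gen S u -> V u.
Proof.
move=> hV SV SVV u Su; have [V0 VD VZ] := hV; have [G0 GD GZ GB] := lie_genP S.
pose A := [set u | V u /\ lie_gen S u]%classic; suff : A u by case.
apply: (Su A); split=> [|s Ss]; last by split; [exact: SV|move=> B [_]; apply].
split=> [//|a b [Va Sa] [Vb Sb]|c a [Va Sa]|a b [Va Sa] [Vb Sb]].
- by split; [apply: VD|apply: GD].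
- by split; [apply: VZ|apply: GZ].
- by split; [apply: (lie_gen_sub_lbr hV SVV)|apply: GB].
Qed.

End Span.

Definition good_brackets (G : dynkin) (L : lieRingType) (e : vertex G -> L) : set L :=
  fun u => exists2 w, good w & u = br e w.

(** Bracketing a good word of weight b with e_x gives 0 if <b, x> >= 0, and a good word
    otherwise, as then <b, x> = -1. *)
Lemma lie_gen_good (G : dynkin) (R : comNzRingType) (L : lieAlgType R)
    (e : vertex G -> L) : dynkin_wf G ->
    (forall w x, good w -> 0 <= pairing (wt w) x -> [!e x, br e w] = 0) ->
  forall u, lie_gen (range e) u -> lspan (good_brackets e) u.
Proof.
move=> wfG h0; have hV := lspan_closed (good_brackets e).
apply: lie_gen_sub => // [_ [x _ <-]|_ v [x _ <-]].
  by apply: mem_lspan; exists [:: x].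
apply: lspan_lbr => _ [w gw ->].
have [p|p] := leP 0 (pairing (wt w) x); first by rewrite h0 //; case: hV.
apply: mem_lspan; exists (x :: w); rewrite ?br_cons //.
by apply: good_cons => //; have := pairing_good_ge wfG x gw; lia.
Qed.

(** * Raising and lowering in the simple Lie algebra *)

Section Weights.
Variables (C : numFieldType) (G : dynkin).
Implicit Types (b : {ffun vertex G -> int}).

Definition wtC b : weight C G := [ffun x => (pairing b x)%:~R].

Lemma wtCD b b' : wtC (b + b') = wtC b + wtC b'.
Proof. by apply/ffunP => x; rewrite !ffunE pairingD rmorphD. Qed.

Lemma wtCN b : wtC (- b) = - wtC b.
Proof. by apply/ffunP => x; rewrite !ffunE pairingN rmorphN. Qed.

Lemma wtC_alpha x : wtC (alpha x) = simple_root C x.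
Proof. by apply/ffunP => y; rewrite !ffunE pairing_alpha. Qed.

(** An element of the radical of the Cartan form has norm 0, hence is 0. *)
Lemma wtC_inj : dynkin_wf G -> injective wtC.
Proof.
move=> wfG b b' /ffunP e; apply/eqP; rewrite -subr_eq0; apply/eqP.
apply: (norm_eq0 wfG); rewrite {1}/bform big1 // => x _.
by have := e x; rewrite !ffunE => /intr_inj; rewrite pairingD pairingN => ->;
  rewrite subrr mulr0.
Qed.

Lemma wtC0 : wtC 0 = 0.
Proof. by apply: (addrI (wtC 0)); rewrite -wtCD !addr0. Qed.

Lemma wtCMn b p : wtC (b *+ p) = wtC b *+ p.
Proof. by elim: p => [|p IHp]; rewrite ?mulr0n ?wtC0 // !mulrSr wtCD IHp. Qed.

End Weights.

Section RootSpaces.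
Variables (C : numFieldType) (gC : lieVectType C) (G : dynkin).
Variable c : chevalley_gens gC G.
Implicit Types (b : {ffun vertex G -> int}) (u v : gC) (a : weight C G) (x y : vertex G).

Lemma root_space_lbr a a' u v :
  in_root_space c a u -> in_root_space c a' v -> in_root_space c (a + a') [!u, v].
Proof.
by move=> hu hv x; rewrite jacobiE hu hv lbrZl lbrZr -scalerDl ffunE.
Qed.

Lemma chE_root_space x : in_root_space c (wtC C (alpha x)) (chE c x).
Proof. by move=> y; rewrite chHE ffunE pairing_alpha. Qed.

Lemma br_root_space w : good w -> in_root_space c (wtC C (wt w)) (br (chE c) w).
Proof.
elim: w => // x w IHw gxw; have [[z [-> ->]]|[_ [_ [[<- <-] gw pw]]]] := goodP gxw.
  by rewrite wt1; apply: chE_root_space.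
by rewrite br_cons // wt_cons wtCD; apply: root_space_lbr (chE_root_space x) (IHw gw).
Qed.

Lemma chFE x y : [!chF c x, chE c y] = if x == y then - chH c x else 0.
Proof. by rewrite lbrC chEF eq_sym; case: eqP => [->|]; rewrite ?oppr0. Qed.

(** Root vectors for distinct weights are independent: a weight vector that is a sum of
    vectors of other weights is 0. *)
Lemma lspan_root_space (X : set gC) (P : weight C G -> Prop) a v :
    (forall u, X u -> exists2 a', P a' & in_root_space c a' u) ->
  lspan X v -> in_root_space c a v -> ~ P a -> v = 0.
Proof.
move=> XP Xv va Pa.
have {X XP Xv} : exists2 s : seq (weight C G * gC),
    forall p, p \in s -> P p.1 /\ in_root_space c p.1 p.2 & v = \sum_(p <- s) p.2.
  pose V : set gC := fun v => exists2 s : seq (weight C G * gC),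
    forall p, p \in s -> P p.1 /\ in_root_space c p.1 p.2 & v = \sum_(p <- s) p.2.
  apply: (lspan_sub (V := V) _ _ Xv); last first.
    move=> u /XP[a' Pa' ua']; exists [:: (a', u)]; last by rewrite big_seq1.
    by move=> p; rewrite inE => /eqP->.
  split=> [|u1 u2 [s1 h1 ->] [s2 h2 ->]|k u [s h ->]].
  - by exists [::]; rewrite ?big_nil.
  - exists (s1 ++ s2); last by rewrite big_cat.
    by move=> p; rewrite mem_cat => /orP[/h1|/h2].
  - exists [seq (p.1, k *: p.2) | p <- s]; last by rewrite big_map scaler_sumr.
    move=> _ /mapP[p /h[Pp hp] ->]; split=> // x /=.
    by rewrite lbrZr hp !scalerA mulrC.
case=> s hs vE.
have [k {}vE] : exists k : weight C G * gC -> C, v = \sum_(p <- s) k p *: p.2.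
  by exists (fun=> 1); rewrite vE; apply: eq_bigr => p _; rewrite scale1r.
elim: s v k va hs vE => [|[a' u] s IHs] v k va hs vE.
  by rewrite vE big_nil.
have [Pa' ua'] : P a' /\ in_root_space c a' u by apply: (hs (a', u)); rewrite inE eqxx.
have [x ax] : exists x, a x != a' x.
  apply/existsP; apply: contra_notT Pa => /existsPn h.
  by have -> : a = a' by apply/ffunP => x; apply/eqP; rewrite -[_ == _]negbK h.
(* H_x - a'(x) kills the first summand and multiplies v by a(x) - a'(x), which is
   not 0 *)
have Dv : (a x - a' x) *: v = \sum_(p <- s) (k p * (p.1 x - a' x)) *: p.2.
  rewrite scalerBl -va {1 2}vE big_cons lbrDr lbrZr ua' scalerDr.
  rewrite !scalerA mulrC opprD addrACA subrr add0r.
  elim: s hs {IHs vE} => [|p s IHs] hs; first by rewrite !big_nil lbr0r scaler0 subrr.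
  have [_ hp] : P p.1 /\ in_root_space c p.1 p.2 by apply: hs; rewrite !inE eqxx orbT.
  rewrite !big_cons -IHs; last first.
    by move=> q; rewrite inE => /orP[/eqP->|qs]; apply: hs; rewrite !inE ?eqxx ?qs ?orbT.
  rewrite lbrDr lbrZr hp scalerDr !scalerA opprD addrACA -scalerBl.
  by congr (_ *: _ + _); ring.
have : (a x - a' x) *: v = 0.
  apply: (IHs _ _ _ _ Dv) => [y|p ps]; last by apply: hs; rewrite inE ps orbT.
  by rewrite lbrZr va !scalerA mulrC.
by move/eqP; rewrite scaler_eq0 subr_eq0 (negPf ax) => /eqP.
Qed.


Hypothesis wfG : dynkin_wf G.
Hypothesis simple_gC : lie_simple gC.
Hypothesis H_neq0 : forall x, chH c x <> 0.

Lemma chE_neq0 x : chE c x <> 0.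
Proof. by move=> E0; apply: (H_neq0 (x := x)); have := chEF c x x; rewrite E0 lbr0l eqxx. Qed.

Lemma lie_ideal_gens (J : set gC) : lin_closed J ->
    (forall x u, J u -> J [!chE c x, u]) -> (forall x u, J u -> J [!chF c x, u]) ->
  lie_ideal J.
Proof.
move=> hJ JE JF; have [J0 JD JZ] := hJ; split=> // x y Jy.
have Sx : lie_gen (range (chE c) `|` range (chF c)) x by rewrite (ch_gen c).
by apply: (lie_gen_sub_lbr hJ _ Sx Jy) => s v [] [z _ <-]; [apply: JE|apply: JF].
Qed.

(** Applying the E_x repeatedly to v spans an ideal J, because v is killed by the F_y.
    All weights in J have height at least 2, so that J does not contain E_x and is
    proper; by simplicity it is 0. *)
Lemma lowering_eq0 b v x : \sum_y b y >= 2 -> in_root_space c (wtC C b) v ->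
  (forall y, [!chF c y, v] = 0) -> v = 0.
Proof.
move=> b2 vb Fv.
pose raise s := foldr (fun x u => [!chE c x, u]) v s.
pose J := lspan (fun u : gC => exists s, u = raise s).
have raise_wt s : in_root_space c (wtC C (wt s + b)) (raise s).
  elim: s => [|y s IHs]; first by rewrite /wt big_nil add0r.
  by rewrite wt_cons -addrA wtCD; apply: root_space_lbr (chE_root_space y) IHs.
have [J0 JD JZ] := lspan_closed (fun u : gC => exists s, u = raise s).
have Jr s : J (raise s) by apply: mem_lspan; exists s.
have JE y u : J u -> J [!chE c y, u].
  by apply: lspan_lbr => _ [s ->]; apply: (Jr (y :: s)).
have JH y u : J u -> J [!chH c y, u].
  by apply: lspan_lbr => _ [s ->]; rewrite raise_wt; apply: JZ; apply: Jr.
have JF y u : J u -> J [!chF c y, u].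
  apply: lspan_lbr => _ [s ->]; elim: s => [|z s IHs]; first by rewrite /= Fv.
  rewrite /= jacobiE chFE; apply: JD; last exact: JE.
  case: eqP => _; last by rewrite lbr0l; apply: J0.
  by rewrite lbrNl -scaleN1r; apply: JZ; apply: JH; apply: Jr.
have [_ /(_ J (lie_ideal_gens (lspan_closed _) JE JF)) [J_0|J_T]] := simple_gC.
  by have := Jr [::]; rewrite J_0.
case: (chE_neq0 (x := x)).
apply: (lspan_root_space (P := fun a => exists s, a = wtC C (wt s + b))
         (X := fun u : gC => exists s, u = raise s) _ _ (chE_root_space x)).
- by move=> _ [s ->]; exists (wtC C (wt s + b)) => //; exists s.
- by rewrite -/(J _) J_T.
case=> s /(wtC_inj wfG) E; have := sum_wt [:: x]; rewrite wt1 E.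
under eq_bigr do rewrite ffunE.
rewrite big_split /= !sum_wt => h.
suff : (2 : int) <= (size [:: x])%:Z - (size s)%:Z by rewrite /=; lia.
by rewrite -h addrAC subrr add0r.
Qed.

Lemma chE_comm x y : x != y -> ~~ adj x y -> [!chE c x, chE c y] = 0.
Proof.
move=> xy na; have cxy := cartan_nadj xy na.
have H_E z : [!chH c z, chE c x] = (cartan z x)%:~R *: chE c x by rewrite chHE.
apply: (lowering_eq0 (b := alpha x + alpha y) x).
- by rewrite -(wt1 y) -wt_cons sum_wt.
- by rewrite wtCD; apply: root_space_lbr; apply: chE_root_space.
move=> z; rewrite jacobiE !chFE.
have [zx|zx] := eqVneq z x; have [zy|zy] := eqVneq z y.
- by rewrite -zx zy eqxx in xy.
- by rewrite zx lbr0r addr0 lbrNl chHE cxy scale0r oppr0.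
- by rewrite zy lbr0l add0r lbrNr lbrC opprK chHE cartanC cxy scale0r.
- by rewrite lbr0l lbr0r addr0.
Qed.

Lemma lower_br_step x w : good w -> pairing (wt w) x = -1 -> [!chF c x, br (chE c) w] = 0 ->
  [!chF c x, br (chE c) (x :: w)] = br (chE c) w.
Proof.
move=> gw px F0; rewrite br_cons // jacobiE F0 lbr0r addr0 chFE eqxx lbrNl.
by rewrite br_root_space // ffunE px scaleN1r opprK.
Qed.

(** F_y lowers and E_x raises brackets of good words in a mutual induction on the size of
    the word: lowering words of size n involves raising words of size less than n, since
    F_y [E_z, br w'] with y adjacent to z leads to [E_z, br w''] with w'' two letters
    shorter. *)
Lemma lower_br_eq0_of n :
    (forall w x, (size w < n)%N -> good w -> 0 <= pairing (wt w) x ->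
       [!chE c x, br (chE c) w] = 0) ->
  forall w y, (size w <= n)%N -> good w -> pairing (wt w) y <= 0 ->
    [!chF c y, br (chE c) w] = 0.
Proof.
move=> raise0 w; have [k] := ubnP (size w); elim: k w => // k IHk w + y.
case: w => // z w; rewrite [size _]/= ltnS => szk szn gzw py.
have [[t [zt w0]]|[_ [_ [[<- <-] gw pw]]]] := goodP gzw.
  rewrite w0 /= chFE; case: eqP => // yz.
  by move: py; rewrite w0 wt1 pairing_alpha yz cartanxx.
have zy : y != z.
  by apply: contraTneq py => ->; rewrite pairing_cons cartanxx pw.
rewrite br_cons // jacobiE chFE (negPf zy) lbr0l add0r.
have [py0|py1] := leP (pairing (wt w) y) 0.
  by rewrite IHk ?lbr0r //; exact: ltnW.
move: py; rewrite pairing_cons; have [a|na] := boolP (adj y z); last first.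
  by rewrite cartan_nadj // add0r leNgt py1.
rewrite cartan_adj // => py.
have {py1}py : pairing (wt w) y = 1 by lia.
have [w3 [gw3 pw3 wt3 e3]] := br_move_front wfG chE_comm gw py.
have sz3 : (size w3).+1 = size w.
  by apply/eqP; rewrite -eqz_nat -(sum_wt (y :: w3)) wt3 sum_wt.
apply: eq_sign0; apply: eq_sign_trans (eq_sign_brr _ (eq_sign_brr _ e3)) _.
rewrite lower_br_step // ?raise0; [by left| |by []| |]; last first.
- by apply: IHk; rewrite ?pw3 //; lia.
- by have := pairing_cons y w3 z; rewrite wt3 pw cartan_adj 1?adjC //; lia.
- lia.
Qed.

(** The bracket has height at least 2, so it is enough that each F_y kills it. For
    y <> x lowering br w gives 0, or -H_y if w is the letter y, or a shorter word w' with
    <wt w', x> >= <wt w, x>, to which induction applies; for y = x the contributions of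
    H_x and of the lowered word cancel. *)
Lemma raise_br_eq0 w x : good w -> 0 <= pairing (wt w) x -> [!chE c x, br (chE c) w] = 0.
Proof.
have [n] := ubnP (size w); elim: n w x => // n IHn w x; rewrite ltnS => szn gw px.
have raise0 w' x' : (size w' < size w)%N -> good w' -> 0 <= pairing (wt w') x' ->
    [!chE c x', br (chE c) w'] = 0.
  by move=> sz'; apply: IHn; apply: leq_trans sz' szn.
have lower0 := lower_br_eq0_of raise0.
have [wx|wx] := eqVneq w [:: x]; first by rewrite wx lbrxx.
apply: (lowering_eq0 (b := wt (x :: w)) x).
- by rewrite sum_wt; case: w gw {px szn raise0 lower0 wx}.
- by rewrite wt_cons wtCD; apply: root_space_lbr (chE_root_space x) (br_root_space gw).
have front y : pairing (wt w) y = 1 -> exists w', [/\ good w', (size w' < size w)%N,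
    wt (y :: w') = wt w, eq_sign (br (chE c) w) [!chE c y, br (chE c) w']
    & [!chF c y, [!chE c y, br (chE c) w']] = br (chE c) w'].
  move=> py; have [w3 [gw3 pw3 wt3 e3]] := br_move_front wfG chE_comm gw py.
  have sz3 : (size w3).+1 = size w.
    by apply/eqP; rewrite -eqz_nat -(sum_wt (y :: w3)) wt3 sum_wt.
  exists w3; split=> //; first by rewrite -sz3.
    by rewrite -br_cons.
  rewrite -br_cons // lower_br_step //; apply: lower0; rewrite ?pw3 //.
  by rewrite -sz3.
move=> y; rewrite jacobiE chFE; have [->|yx] := eqVneq y x.
  rewrite lbrNl br_root_space // ffunE.
  have [p|p|p|w1] := pairing_good wfG x gw; last by rewrite w1 eqxx in wx.
  - by rewrite p in px.
  - by rewrite p scale0r oppr0 add0r lower0 ?p ?lbr0r.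
  - have [w3 [_ _ _ [->|->] e4]] := front x p; rewrite p scale1r ?lbrNr e4 ?lbrNr addNr //.
rewrite lbr0l add0r; have [p|p|p|w1] := pairing_good wfG y gw.
- by rewrite lower0 ?p ?lbr0r.
- by rewrite lower0 ?p ?lbr0r.
- have [w3 [gw3 sz3 wt3 e3 e4]] := front y p.
  apply: eq_sign0; apply: eq_sign_trans (eq_sign_brr _ (eq_sign_brr _ e3)) _.
  rewrite e4 raise0 //; first by left.
  by move: px; rewrite -wt3 pairing_cons cartan_neq 1?eq_sym //; lia.
move: px; rewrite w1 wt1 pairing_alpha /= cartan_neq 1?eq_sym // chFE eqxx lbrNr.
move=> h; rewrite lbrC opprK chHE cartan_neq //.
by rewrite adjC in h; case: (adj y x) h => // _; rewrite oppr0 scale0r.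
Qed.

Lemma lower_br_eq0 w x : good w -> pairing (wt w) x <= 0 -> [!chF c x, br (chE c) w] = 0.
Proof.
by apply: (@lower_br_eq0_of (size w)) => // w' x' _; apply: raise_br_eq0.
Qed.

Lemma lower_br w x : good w -> pairing (wt w) x = -1 ->
  [!chF c x, br (chE c) (x :: w)] = br (chE c) w.
Proof. by move=> gw px; rewrite lower_br_step // lower_br_eq0 ?px. Qed.

Lemma br_chE_neq0 w : good w -> br (chE c) w <> 0.
Proof.
elim: w => // x w IHw gxw; have [[z [-> ->]]|[_ [_ [[<- <-] gw pw]]]] := goodP gxw.
  exact: chE_neq0.
by move=> h; apply: IHw => //; rewrite -(lower_br gw pw) h lbr0r.
Qed.

Lemma is_root_good w : good w -> is_root c (wtC C (wt w)).
Proof.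
move=> gw; split.
  rewrite -(wtC0 C) => /(wtC_inj wfG) E.
  by have := norm_good gw; rewrite E bform0l.
by exists (br (chE c) w); split; [apply: br_chE_neq0|apply: br_root_space].
Qed.

End RootSpaces.

(** * Roots and Chevalley bases *)

Section OppositeGenerators.
Variables (C : fieldType) (gC : lieVectType C) (G : dynkin).
Variable c : chevalley_gens gC G.

Let oppHH x y : [!- chH c x, - chH c y] = 0.
Proof. by rewrite lbrNl lbrNr chHH !oppr0. Qed.
Let oppEF x y : [!chF c x, chE c y] = if x == y then - chH c x else 0.
Proof. by rewrite lbrC chEF eq_sym; case: eqP => [->|]; rewrite ?oppr0. Qed.
Let oppHE x y : [!- chH c x, chF c y] = (cartan x y)%:~R *: chF c y.
Proof. by rewrite lbrNl chHF scaleNr opprK. Qed.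
Let oppHF x y : [!- chH c x, chE c y] = - (cartan x y)%:~R *: chE c y.
Proof. by rewrite lbrNl chHE scaleNr. Qed.
Let opp_gen : lie_gen (range (chF c) `|` range (chE c)) = [set: gC]%classic.
Proof. by rewrite setUC ch_gen. Qed.

Definition opp_gens : chevalley_gens gC G :=
  {| chE := chF c; chH := fun x => - chH c x; chF := chE c; chHH := oppHH;
     chEF := oppEF; chHE := oppHE; chHF := oppHF; ch_gen := opp_gen |}.

End OppositeGenerators.

Section RootSystem.
Variables (C : numFieldType) (gC : lieVectType C) (G : dynkin).
Hypothesis wfG : dynkin_wf G.
Hypothesis simple_gC : lie_simple gC.
Implicit Types (c : chevalley_gens gC G) (u : gC).

(** H_x is scaled so that the opposite generators, whose H_x is the opposite one, give
    the same set. *)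
Inductive triangular c : set gC :=
| TriH k x : triangular c (k *: chH c x)
| TriE w of good w : triangular c (br (chE c) w)
| TriF w of good w : triangular c (br (chF c) w).

Lemma triangular_opp c u : triangular (opp_gens c) u <-> triangular c u.
Proof.
split; case=> [k x|w gw|w gw].
- by rewrite /= scalerN -scaleNr; apply: TriH.
- exact: (TriF _ gw).
- exact: (TriE _ gw).
- by rewrite -[k]opprK scaleNr -scalerN; apply: (TriH (opp_gens c)).
- exact: (TriF (opp_gens c) gw).
- exact: (TriE (opp_gens c) gw).
Qed.

Lemma lspan_triangularE c : (forall x, chH c x <> 0) ->
  forall x u, lspan (triangular c) u -> lspan (triangular c) [!chE c x, u].
Proof.
move=> H0 x; have [T0 TD TZ] := lspan_closed (triangular c).
have oppH0 y : chH (opp_gens c) y <> 0.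
  by move=> /eqP; rewrite oppr_eq0 => /eqP; apply: H0.
apply: lspan_lbr => _ [k y|w gw|w gw].
- rewrite lbrZr lbrC chHE -scaleNr scalerA; apply: TZ.
  by apply: mem_lspan; apply: (@TriE c [:: x]).
- have [p|p] := leP 0 (pairing (wt w) x); first by rewrite raise_br_eq0.
  rewrite -br_cons //; apply: mem_lspan; apply: TriE; apply: good_cons => //.
  by have := pairing_good_ge wfG x gw; lia.
have low y w' : good w' -> pairing (wt w') y <= 0 -> [!chE c y, br (chF c) w'] = 0.
  exact: (lower_br_eq0 (c := opp_gens c) wfG simple_gC oppH0).
have [p|p|p|->] := pairing_good wfG x gw.
- by rewrite low ?p.
- by rewrite low ?p.
- have [w3 [gw3 pw3 _ e3]] :=
    br_move_front wfG (chE_comm (c := opp_gens c) wfG simple_gC oppH0) gw p.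
  apply: lspan_eq_sign (eq_sign_brr _ e3) _.
  rewrite (lower_br (c := opp_gens c) wfG simple_gC oppH0 gw3 pw3).
  by apply: mem_lspan; apply: TriF.
- by rewrite /= chEF eqxx -[chH c x]scale1r; apply: mem_lspan; apply: TriH.
Qed.

(** The span contains the generators and is stable under bracketing with them: for the
    E_x this is lspan_triangularE, for the F_x the same lemma for the opposite
    generators. *)
Lemma lspan_triangularT c : (forall x, chH c x <> 0) -> forall u, lspan (triangular c) u.
Proof.
move=> H0 u; have : lie_gen (range (chE c) `|` range (chF c)) u by rewrite (ch_gen c).
have oppH0 y : chH (opp_gens c) y <> 0.
  by move=> /eqP; rewrite oppr_eq0 => /eqP; apply: H0.
have opp v : lspan (triangular (opp_gens c)) v <-> lspan (triangular c) v.
  by split; (apply: lspan_sub; first exact: lspan_closed) => v' /triangular_opp;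
    apply: mem_lspan.
apply: (lie_gen_sub (lspan_closed (triangular c))).
  move=> _ [] [x _ <-]; apply: mem_lspan.
    exact: (@TriE c [:: x]).
  exact: (@TriF c [:: x]).
move=> _ v [] [x _ <-]; first exact: lspan_triangularE.
by move=> /opp Vv; apply/opp; apply: (lspan_triangularE oppH0).
Qed.

(** The spanning vectors of lspan_triangularT have weights of norm 0 or 2. *)
Lemma is_root_norm c b : (forall x, chH c x <> 0) ->
  is_root c (wtC C b) -> bform b b <= 2.
Proof.
move=> H0 [_ [v [v0 vb]]]; rewrite leNgt; apply/negP => b2; apply: v0.
apply: (lspan_root_space (c := c) (X := triangular c)
  (P := fun a => exists2 b', bform b' b' <= 2 & a = wtC C b') _ _ vb).
- move=> _ [k x|w gw|w gw].
  + exists (wtC C 0); first by exists 0 => //; rewrite bform0l.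
    by move=> y; rewrite lbrZr chHH wtC0 ffunE scaler0 scale0r.
  + by exists (wtC C (wt w)); [exists (wt w); rewrite // norm_good|apply: br_root_space].
  + exists (wtC C (- wt w)).
      by exists (- wt w) => //; rewrite bformNr bformNl opprK norm_good.
    move=> y; have := br_root_space (opp_gens c) gw y.
    by rewrite lbrNl => /(canRL opprK)->; rewrite !ffunE pairingN rmorphN scaleNr.
- exact: lspan_triangularT.
- by case=> b' b'2 /(wtC_inj wfG) E; rewrite E ltNge b'2 in b2.
Qed.

Section Basis.
Variables (c : chevalley_gens gC G) (B : chevalley_basis c).

Lemma basis_chH_neq0 x : chH c x <> 0.
Proof.
have /basis_free := cb_basis B => /free_not0 h; apply/eqP/h.
by rewrite mem_cat map_f // mem_enum.
Qed.

(** A string b - p a with (b, a) = -1 has norm 2 + 2 p + 2 p ^ 2, so that it leaves the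
    root system at once, and the structure constants involved are 1 or -1. *)
Lemma br_chE_basis w : good w -> eq_sign (br (chE c) w) (cb_E B (wtC C (wt w))).
Proof.
have H0 := basis_chH_neq0.
elim: w => // x w IHw gxw; have [[z [-> ->]]|[_ [_ [[<- <-] gw pw]]]] := goodP gxw.
  by left; rewrite wt1 wtC_alpha cb_simple.
rewrite br_cons //; apply: eq_sign_trans (eq_sign_brr _ (IHw gw)) _.
have rootw := is_root_good wfG simple_gC H0 gw.
have rootxw := is_root_good wfG simple_gC H0 gxw.
have rootx : is_root c (simple_root C x).
  by rewrite -wtC_alpha -wt1; apply: is_root_good.
have addw : simple_root C x + wtC C (wt w) = wtC C (wt (x :: w)).
  by rewrite wt_cons wtCD wtC_alpha.
have [|||s [p [[rp _]]]] := @cb_const _ _ _ _ B (simple_root C x) (wtC C (wt w)).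
- exact/(cb_PhiP B).
- exact/(cb_PhiP B).
- by rewrite addw; apply/(cb_PhiP B).
have {rp} -> : p = 0%N.
  move: rp; rewrite -wtC_alpha -wtCMn -wtCN -wtCD => /(is_root_norm H0).
  by rewrite norm_sub_alpha norm_good // pw; nia.
rewrite cb_simple addw mulr1 => ->.
by case: s; rewrite ?expr0 ?expr1 ?scaleN1r ?scale1r; [right|left].
Qed.

End Basis.
End RootSystem.

(** * Homomorphisms out of free Lie algebras and quotients *)

Section LieHom.
Variable R : comNzRingType.
Implicit Types L : lieAlgType R.

Lemma lie_homD L L' (f : L -> L') : lie_hom f -> {morph f : u v / u + v}.
Proof. by case=> fl _ u v; rewrite -[u]scale1r fl !scale1r. Qed.

Lemma lie_hom0 L L' (f : L -> L') : lie_hom f -> f 0 = 0.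
Proof. by move=> hf; apply: (addrI (f 0)); rewrite -lie_homD // !addr0. Qed.

Lemma lie_homZ L L' (f : L -> L') : lie_hom f -> forall c u, f (c *: u) = c *: f u.
Proof. by move=> hf c u; rewrite -[c *: u]addr0 hf.1 lie_hom0 // addr0. Qed.

Lemma lie_hom_comp L L' L'' (g : L' -> L'') (f : L -> L') :
  lie_hom g -> lie_hom f -> lie_hom (g \o f).
Proof.
by move=> [gl gb] [fl fb]; split=> [c u v|u v] /=; [rewrite fl gl|rewrite fb gb].
Qed.

Lemma lie_gen_ind L (S : set L) (P : L -> Prop) :
  lie_subalgebra P -> (forall s, S s -> P s) -> forall u, lie_gen S u -> P u.
Proof. by move=> hP SP u; apply. Qed.

Lemma lie_gen_mem L (S : set L) u : S u -> lie_gen S u.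
Proof. by move=> Su A [_]; apply. Qed.

Lemma lie_hom_subalgebra L L' (f : L -> L') (A : set L') :
  lie_hom f -> lie_subalgebra A -> lie_subalgebra (fun u => A (f u)).
Proof.
move=> hf [A0 AD AZ AB]; split=> [|u v|c u|u v]; rewrite ?(lie_hom0 hf) ?(lie_homD hf) ?(lie_homZ hf) //.
- exact: AD.
- exact: AZ.
- by rewrite hf.2; apply: AB.
Qed.

Lemma lie_gen_hom L L' (f : L -> L') (S : set L) (S' : set L') : lie_hom f ->
  (forall s, S s -> S' (f s)) -> forall u, lie_gen S u -> lie_gen S' (f u).
Proof.
move=> hf SS'; apply: lie_gen_ind; first exact: (lie_hom_subalgebra hf (lie_genP S')).
by move=> s Ss; apply: lie_gen_mem; apply: SS'.
Qed.

Lemma lie_hom_ext L L' (f g : L -> L') (S : set L) : lie_hom f -> lie_hom g ->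
  (forall s, S s -> f s = g s) -> forall u, lie_gen S u -> f u = g u.
Proof.
move=> hf hg fg; apply: lie_gen_ind => //.
split=> [|u v eu ev|c u eu|u v eu ev].
- by rewrite (lie_hom0 hf) (lie_hom0 hg).
- by rewrite (lie_homD hf) (lie_homD hg) eu ev.
- by rewrite (lie_homZ hf) (lie_homZ hg) eu.
- by rewrite hf.2 hg.2 eu ev.
Qed.

Lemma sub_lie_val_hom L (S : set L) : lie_hom (@sub_lie_val R L S).
Proof.
split=> [c u v|//].
by rewrite -[LHS]/(val (c *: u + v)) linearP.
Qed.

(** Lift the variables to the subalgebra that they generate: composed with the inclusion,
    this is the identity of the free Lie algebra by uniqueness of lifts. *)
Lemma free_lie_gen (X : Type) (u : free_lie R X) : lie_gen (range (@free_lie_var R X)) u.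
Proof.
pose S := range (@free_lie_var R X).
have Sx x : S (free_lie_var R x) by exists x.
pose i x : sub_lie S := SubLie (mem_lie_gen (Sx x)).
have [hl lv] := free_lie_liftP i.
have -> : u = sub_lie_val (free_lie_lift i u).
  transitivity (free_lie_lift (free_lie_var R (X:=X)) u).
    by apply: (free_lie_lift_uniq (g := id)).
  symmetry; apply: (free_lie_lift_uniq (g := @sub_lie_val _ _ _ \o free_lie_lift i)).
    exact: lie_hom_comp (sub_lie_val_hom _) hl.
  by move=> x /=; rewrite lv.
exact: asboolW (sub_lie_valP (free_lie_lift i u)).
Qed.

Lemma lie_quot_pi_surj L (S : set L) (u : lie_quot S) : exists v, u = lie_quot_pi S v.
Proof. by exists (repr u); rewrite /lie_quot_pi reprK. Qed.

Lemma lie_quot_lift L L' (S : set L) (f : L -> L') : lie_hom f ->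
    (forall s, S s -> f s = 0) ->
  exists2 g : lie_quot S -> L', lie_hom g & forall u, g (lie_quot_pi S u) = f u.
Proof.
move=> hf fS.
have ker u : lie_ideal_gen S u -> f u = 0.
  pose N : set L := fun u => f u = 0.
  rewrite -/(N u) => /(_ N); apply; split; last exact: fS.
  split=> [|v w fv fw|c v fv|v w fw]; rewrite /N.
  - exact: lie_hom0.
  - by rewrite (lie_homD hf) fv fw addr0.
  - by rewrite (lie_homZ hf) fv scaler0.
  - by rewrite hf.2 fw lbr0r.
pose g (u : lie_quot S) := f (repr u).
have gE u : g (lie_quot_pi S u) = f u.
  have /lie_quot_piP/ker : lie_quot_pi S (repr (lie_quot_pi S u)) = lie_quot_pi S u.
    by rewrite {1}/lie_quot_pi reprK.
  by rewrite -scaleN1r (lie_homD hf) (lie_homZ hf) scaleN1r => /subr0_eq.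
have [pl pb] := lie_quot_pi_hom S.
exists g => //; split=> [c u v|u v].
  have [u' ->] := lie_quot_pi_surj u; have [v' ->] := lie_quot_pi_surj v.
  by rewrite -pl !gE hf.1.
have [u' ->] := lie_quot_pi_surj u; have [v' ->] := lie_quot_pi_surj v.
by rewrite -pb !gE hf.2.
Qed.

Lemma lie_quot_gen L (S X : set L) :
    (forall u, lie_gen X u) ->
  forall u : lie_quot S, lie_gen (lie_quot_pi S @` X)%classic u.
Proof.
move=> gX u; have [v ->] := lie_quot_pi_surj u.
by apply: (lie_gen_hom (lie_quot_pi_hom S) _ (gX v)) => x Xx; exists x.
Qed.

Lemma br_hom (G : dynkin) L L' (f : L -> L') (e : vertex G -> L) (e' : vertex G -> L') :
  lie_hom f -> (forall x, f (e x) = e' x) -> forall w, f (br e w) = br e' w.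
Proof.
move=> hf fe; elim=> [|x [|y w] IHw] /=; first exact: lie_hom0.
  exact: fe.
by rewrite hf.2 fe; congr [!_, _].
Qed.

End LieHom.

(** * The Chevalley algebra satisfies the relations of L(0) *)

Section ZForm.
Variables (C : numFieldType) (gC : lieVectType C) (G : dynkin).
Variables (c : chevalley_gens gC G) (B : chevalley_basis c).
Hypothesis wfG : dynkin_wf G.
Hypothesis simple_gC : lie_simple gC.

Lemma val_zform_br w : val (br (zform_E B) w) = br (chE c) w.
Proof.
elim: w => [|x [|y w] IHw] //.
by rewrite -[LHS]/[!chE c x, val (br (zform_E B) (y :: w))] IHw.
Qed.

Lemma zform_raise_br_eq0 w x : good w -> 0 <= pairing (wt w) x ->
  [!zform_E B x, br (zform_E B) w] = 0.
Proof.
move=> gw px; apply: val_inj; rewrite [RHS]raddf0.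
rewrite -[LHS]/[!chE c x, val (br (zform_E B) w)] val_zform_br.
by rewrite raise_br_eq0 //; apply: (basis_chH_neq0 B).
Qed.

Lemma basis_coord a : a \in cb_Phi B -> exists xi : {scalar gC},
  (forall x, xi (chH c x) = 0) /\
  forall b, b \in cb_Phi B -> xi (cb_E B b) = (a == b)%:R.
Proof.
set Hs := [seq chH c x | x <- enum (vertex G)].
set Es := [seq cb_E B a | a <- cb_Phi B].
pose X := in_tuple (Hs ++ Es).
have freeX : free X by have /basis_free := cb_basis B.
have ltE b : b \in cb_Phi B -> (size Hs + index b (cb_Phi B) < size (Hs ++ Es))%N.
  by move=> Bb; rewrite size_cat ltn_add2l size_map index_mem.
have ltH x : (index x (enum (vertex G)) < size Hs)%N.
  by rewrite size_map index_mem mem_enum.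
move=> Ba; exists (coord X (Ordinal (ltE a Ba))); split=> [x|b Bb].
  have ltx : (index x (enum (vertex G)) < size (Hs ++ Es))%N.
    by rewrite size_cat ltn_addr.
  have -> : chH c x = X`_(Ordinal ltx).
    by rewrite /= nth_cat ltH (nth_map x) ?nth_index ?mem_enum // index_mem mem_enum.
  apply: etrans (coord_free _ _ freeX) _; rewrite -val_eqE /= ltn_eqF //.
  by apply: leq_trans (ltH x) _; rewrite leq_addr.
have -> : cb_E B b = X`_(Ordinal (ltE b Bb)).
  by rewrite /= nth_cat ltnNge leq_addr addKn (nth_map a) ?nth_index // index_mem.
apply: etrans (coord_free _ _ freeX) _; rewrite -val_eqE /= eqn_add2l eq_sym.
congr (nat_of_bool _)%:R; apply/eqP/eqP => [E|->//].
by rewrite -(nth_index a Ba) E nth_index.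
Qed.

(** The coordinate along E_a, an integer on the Z-form. *)
Lemma zform_coef a : a \in cb_Phi B ->
  exists2 n : zform B -> int, {morph n : u v / u + v} &
    forall b u, b \in cb_Phi B -> val u = cb_E B b -> n u = (a == b)%:Z.
Proof.
move=> Ba; have [xi [xiH xiE]] := basis_coord Ba.
have int_xi (u : zform B) : exists n : int, xi (val u) = n%:~R.
  have /asboolP[m [n uE]] := valP u; exists (n a); rewrite uE raddfD !raddf_sum /=.
  rewrite big1 => [|x _]; last by rewrite raddfMz /= xiH mul0rz.
  rewrite add0r (bigD1_seq a) ?cb_Phi_uniq //= raddfMz /= xiE // eqxx.
  rewrite big_seq_cond big1 ?addr0 // => b /andP[Bb ba].
  by rewrite raddfMz /= xiE // eq_sym (negPf ba) mul0rz.
have [n nE] := choice int_xi; exists n => [u v|b u Bb uE]; apply: (@intr_inj C).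
  by rewrite rmorphD /= -!nE -raddfD.
by rewrite -nE uE xiE //; case: eqP.
Qed.

Variable K : comNzRingType.

Lemma br_chE0 w : good w -> br (@chE0 _ _ _ _ B K) w = pure 1 (br (zform_E B) w).
Proof.
elim: w => [//|x [//|y w] IHw] gw; have [[z []//]|[_ [_ [[<- <-] gw' _]]]] := goodP gw.
by rewrite br_cons // IHw // /chE0 pure_br mulr1.
Qed.

Lemma chE0_br_eq0 w x : good w -> 0 <= pairing (wt w) x ->
  [!@chE0 _ _ _ _ B K x, br (@chE0 _ _ _ _ B K) w] = 0.
Proof.
by move=> gw px; rewrite br_chE0 // pure_br zform_raise_br_eq0 // pure0r.
Qed.

(** It is enough to check the sandwich property on good brackets, and there one of the two
    brackets with e_x gives 0: if the first one does not, it raises the pairing with x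
    from -1 to 1. *)
Lemma n_plus_sandwich x (u : n_plus B K) : [!n_plus_E B K x, [!n_plus_E B K x, u]] = 0.
Proof.
apply: val_inj; rewrite [RHS]raddf0.
rewrite -[LHS]/[!chE0 B K x, [!chE0 B K x, val u]].
pose V : set (chevalley_algebra B K) := fun u => [!chE0 B K x, [!chE0 B K x, u]] = 0.
apply: (lspan_sub (V := V) _ _ (lie_gen_good wfG chE0_br_eq0 (asboolW (valP u)))).
  split=> [|a b Va Vb|k a Va]; rewrite /V ?lbr0r //.
    by rewrite !lbrDr Va Vb addr0.
  by rewrite !lbrZr Va scaler0.
move=> _ [w gw ->]; rewrite /V.
have [p|p] := leP 0 (pairing (wt w) x); first by rewrite chE0_br_eq0 // lbr0r.
have p1 : pairing (wt w) x = -1 by have := pairing_good_ge wfG x gw; lia.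
rewrite -br_cons // chE0_br_eq0 ?good_cons //.
by rewrite pairing_cons cartanxx p1.
Qed.

Lemma n_plus_comm (x y : vertex G) : ~~ adj x y -> [!n_plus_E B K x, n_plus_E B K y] = 0.
Proof.
move=> na; apply: val_inj; rewrite [RHS]raddf0 -[LHS]/[!chE0 B K x, br (chE0 B K) [:: y]].
apply: chE0_br_eq0 => //; rewrite wt1 pairing_alpha.
have [->|xy] := eqVneq x y; first by rewrite cartanxx.
by rewrite cartan_nadj.
Qed.

Lemma L0_to_n_plus : exists2 phi : L0 K G -> n_plus B K, lie_hom phi &
  forall x, phi (L0_gen K x) = n_plus_E B K x.
Proof.
have [h0 h0E] := free_lie_liftP (n_plus_E B K).
have [|h1 hom1 h1E] := lie_quot_lift (S := @nonadj_relators K G) h0.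
  by move=> _ [x [y [na ->]]]; rewrite h0.2 !h0E n_plus_comm.
have [|h2 hom2 h2E] := lie_quot_lift (S := @sandwich_relators K G) hom1.
  by move=> _ [x [y ->]]; rewrite !hom1.2 h1E h0E n_plus_sandwich.
by exists h2 => // x; rewrite h2E h1E h0E.
Qed.

End ZForm.

(** * The brackets of good words span L(0) and are independent in n_+ *)

Section L0Structure.
Variables (K : comNzRingType) (G : dynkin).

Lemma L0_generated (u : L0 K G) : lie_gen (range (@L0_gen K G)) u.
Proof.
have : lie_gen (lie_quot_pi (@sandwich_relators K G) @`
    (lie_quot_pi (@nonadj_relators K G) @` range (@free_lie_var K (vertex G))))%classic u.
  by apply: lie_quot_gen; apply: lie_quot_gen; apply: free_lie_gen.
by apply: lie_gen_ind (lie_genP _) _ u => _ [_ [_ [x _ <-] <-] <-]; apply: lie_gen_mem; exists x.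
Qed.

Lemma L0_comm (x y : vertex G) : ~~ adj x y -> [!L0_gen K x, L0_gen K y] = 0.
Proof.
move=> na; have [_ pb] := lie_quot_pi_hom (@sandwich_relators K G).
have [_ pb'] := lie_quot_pi_hom (@nonadj_relators K G).
rewrite /L0_gen -pb /FLie_gen -pb'.
have -> : lie_quot_pi (@nonadj_relators K G) [!free_lie_var K x, free_lie_var K y] =
    lie_quot_pi _ 0.
  apply/lie_quot_piP; rewrite subr0 => A [_]; apply.
  by exists x, y.
rewrite (lie_hom0 (lie_quot_pi_hom (@nonadj_relators K G))).
exact: (lie_hom0 (lie_quot_pi_hom (@sandwich_relators K G))).
Qed.

Lemma L0_sandwich (x : vertex G) (u : L0 K G) : [!L0_gen K x, [!L0_gen K x, u]] = 0.
Proof.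
have [v ->] := lie_quot_pi_surj u.
have [_ pb] := lie_quot_pi_hom (@sandwich_relators K G).
rewrite /L0_gen -(pb (FLie_gen K x) v) -(pb _ [!FLie_gen K x, v]).
rewrite -(lie_hom0 (lie_quot_pi_hom (@sandwich_relators K G))).
by apply/lie_quot_piP; rewrite subr0 => A [_]; apply; exists x, v.
Qed.

End L0Structure.

Section Injectivity.
Variables (K : fieldType) (C : numFieldType) (gC : lieVectType C) (G : dynkin).
Variables (c : chevalley_gens gC G) (B : chevalley_basis c).
Hypothesis wfG : dynkin_wf G.
Hypothesis simple_gC : lie_simple gC.
Hypothesis char2 : 2%N \notin [pchar K].

Lemma L0_spanned (u : L0 K G) : lspan (good_brackets (@L0_gen K G)) u.
Proof.
apply: (lie_gen_good wfG _ (L0_generated u)) => w x.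
apply: (sandwich_br_eq0 wfG); last exact: L0_sandwich.
- move=> v /eqP; rewrite -scaler_nat scaler_eq0 => /orP[/eqP two0|/eqP//].
  by move: char2; rewrite inE /= two0 eqxx.
- by move=> y z _; apply: L0_comm.
Qed.

(** A choice of one good word for each weight that has one. *)
Lemma root_word : exists word : weight C G -> seq (vertex G),
  forall w, good w -> good (word (wtC C (wt w))) /\ wt (word (wtC C (wt w))) = wt w.
Proof.
have /choice[word wordP] (a : weight C G) : exists w0, forall w, good w ->
    wtC C (wt w) = a -> good w0 /\ wt w0 = wt w.
  have [[w0 gw0 w0a]|no] := pselect (exists2 w, good w & wtC C (wt w) = a).
    exists w0 => w gw wa; split=> //.
    by apply: (@wtC_inj C G wfG); rewrite w0a wa.
  by exists [::] => w gw wa; case: no; exists w.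
by exists word => w gw; apply: wordP.
Qed.

(** The left inverse psi reads off the Chevalley coordinates and sends E_a, up to the sign
    s a that relates E_a to the bracket of the chosen word, to the bracket of that word
    in L(0). Good words of the same weight have the same bracket up to sign, so it is
    enough to check psi on the chosen words. *)
Lemma L0_to_n_plus_inj (phi : L0 K G -> n_plus B K) : lie_hom phi ->
  (forall x, phi (L0_gen K x) = n_plus_E B K x) -> injective phi.
Proof.
move=> hphi phiE; have [word wordP] := root_word.
have /choice[n nP] (a : weight C G) : exists n : zform B -> int, a \in cb_Phi B ->
    {morph n : u v / u + v} /\
    forall b u, b \in cb_Phi B -> val u = cb_E B b -> n u = (a == b)%:Z.
  have [Ba|_] := boolP (a \in cb_Phi B); last by exists (fun=> 0).
  by have [n nD nE] := zform_coef Ba; exists n.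
pose z a := br (zform_E B) (word a).
pose s a : K := (-1) ^+ (val (z a) != cb_E B a).
have ss a : s a * s a = 1 by rewrite -expr2 sqrr_sign.
pose M a : L0 K G := s a *: br (@L0_gen K G) (word a).
pose f (k : K) (u : zform B) := \sum_(a <- cb_Phi B) (k * (n a u)%:~R) *: M a.
have fDl k l u : f (k + l) u = f k u + f l u.
  by rewrite -big_split; apply: eq_bigr => a _; rewrite mulrDl scalerDl.
have fDr k u v : f k (u + v) = f k u + f k v.
  rewrite -big_split; apply: eq_big_seq => a /nP[nD _].
  by rewrite nD rmorphD mulrDr scalerDl.
pose iota u : chevalley_algebra B K := val (phi u).
have hiota : lie_hom iota by apply: lie_hom_comp (sub_lie_val_hom _) hphi.
pose psi := tensor_lift f.
suff psiK : cancel iota psi.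
  by move=> u v uv; rewrite -[u]psiK -[v]psiK /iota uv.
have psi_word w k : good w -> w = word (wtC C (wt w)) ->
    psi (iota (k *: br (@L0_gen K G) w)) = k *: br (@L0_gen K G) w.
  set a := wtC C (wt w) => gw wa.
  have Ba : a \in cb_Phi B.
    by apply/(cb_PhiP B)/is_root_good => //; apply: (basis_chH_neq0 B).
  have iotaE : iota (br (@L0_gen K G) w) = pure 1 (z a).
    rewrite (br_hom (e' := @chE0 _ _ _ _ B K) hiota); last first.
      by move=> x; rewrite /iota phiE.
    by rewrite br_chE0 // /z -wa.
  rewrite lie_homZ // iotaE scale_pure mulr1 /psi tensor_lift_pure //.
  have ns b : b \in cb_Phi B -> (n b (z a))%:~R = (b == a)%:R * s a.
    move=> Bb; have [nD nE] := nP b Bb; rewrite /s.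
    case: (val (z a) =P cb_E B a) => [za|za] /=.
      by rewrite (nE a) // expr0 mulr1; case: eqP.
    have zaN : val (- z a) = cb_E B a.
      have -> : val (- z a) = - val (z a) by apply: (raddfN val).
      have := br_chE_basis wfG simple_gC B gw.
      rewrite -(val_zform_br B) -/a wa -/(z a) => -[//|->].
      by rewrite opprK.
    have n0 : n b 0 = 0 by apply: (addrI (n b 0)); rewrite -nD !addr0.
    have -> : n b (z a) = - n b (- z a).
      by apply/eqP; rewrite -addr_eq0 -nD subrr n0.
    by rewrite (nE a) // expr1 mulrN1 rmorphN; case: eqP.
  rewrite /f (bigD1_seq a) ?cb_Phi_uniq //= ns // eqxx mul1r /M -wa.
  rewrite big_seq_cond big1 ?addr0 => [|b /andP[Bb /negPf ba]]; last first.
    by rewrite ns // ba mul0r mulr0 scale0r.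
  by rewrite scalerA -mulrA ss mulr1.
move=> u; rewrite -[u]scale1r; move: (1 : K).
pose V : set (L0 K G) := fun u => forall k, psi (iota (k *: u)) = k *: u.
have psiD : {morph psi : a b / a + b} by apply: tensor_liftD.
have VZ k v : V v -> V (k *: v) by move=> Vv l; rewrite scalerA Vv.
rewrite -/(V u); apply: (lspan_sub (V := V) _ _ (L0_spanned u)).
  split=> // [k|a b Va Vb k]; last first.
    by rewrite scalerDr lie_homD // psiD Va Vb.
  by rewrite scaler0 lie_hom0 //; apply: tensor_lift0.
move=> _ [w gw ->]; set w0 := word (wtC C (wt w)).
have [gw0 wt0] := wordP w gw.
have V0 : V (br (@L0_gen K G) w0).
  by move=> k; apply: psi_word => //; rewrite wt0.
have commE x y : x != y -> ~~ adj x y -> [!@L0_gen K G x, L0_gen K y] = 0.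
  by move=> _; apply: L0_comm.
have [->|->] // := br_wt_inj wfG commE gw gw0 (esym wt0).
by rewrite -scaleN1r; apply: VZ.
Qed.

End Injectivity.

Theorem theorem12 (K : fieldType) (hK : 2%N \notin [pchar K])
    (R : realType) (G : dynkin) (hG : dynkin_wf G)
    (gC : lieVectType R[i]) (hsimple : lie_simple gC)
    (c : chevalley_gens gC G) (B : chevalley_basis c) :
  exists! phi : L0 K G -> n_plus B K,
    lie_iso phi /\ forall x : vertex G, phi (L0_gen K x) = n_plus_E B K x.
Proof.
have [phi hphi phiE] := L0_to_n_plus B hG hsimple K.
exists phi; split; last first.
  move=> phi' [[hphi' _] phiE']; apply/funext => u.
  apply: (lie_hom_ext hphi hphi' _ (L0_generated u)) => _ [x _ <-].
  by rewrite phiE phiE'.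
split=> //; split=> //.
have phi_inj : injective phi by apply: L0_to_n_plus_inj.
have phi_surj v : exists u, phi u = v.
  have : lie_gen (range (@chE0 _ _ _ _ B K)) (val v) by apply: (asboolW (valP v)).
  have im_sub : lie_subalgebra (fun t => exists u, val (phi u) = t :> chevalley_algebra B K).
    have hval := lie_hom_comp (sub_lie_val_hom (range (@chE0 _ _ _ _ B K))) hphi.
    split=> [|_ _ [u1 <-] [u2 <-]|k _ [u <-]|_ _ [u1 <-] [u2 <-]].
    - by exists 0; apply: (lie_hom0 hval).
    - by exists (u1 + u2); apply: (lie_homD hval).
    - by exists (k *: u); apply: (lie_homZ hval).
    - by exists [!u1, u2]; apply: hval.2.
  move/(lie_gen_ind im_sub) => [_ [x _ <-]|u /val_inj <-]; last by exists u.
  by exists (L0_gen K x); rewrite phiE.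
have [psi psiK] := choice phi_surj.
by exists psi => // u; apply: phi_inj; rewrite psiK.
Qed.
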